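(* Let $\Omega\subset\mathbb{R}^n$ be a bounded domain (open and connected) with Lipschitz boundary, and let $\Gamma$ be an open portion of $\partial\Omega$. Let $Q>0$ be a constant such that $\|u-u_\Omega\|_{L^2(\Omega)}\le Q\|\nabla u\|_{L^2(\Omega)}$ for every $u\in W^{1,2}(\Omega)$, and let $K>0$ be a constant such that $$\left\|\nabla u-\tfrac12(\nabla u-(\nabla u)^T)_\Omega\right\|_{L^2(\Omega)}\le K\|\widehat\nabla u\|_{L^2(\Omega)}\quad\text{for every }u\in W^{1,2}(\Omega;\mathbb{R}^n),$$ where $\widehat\nabla u=\frac12(\nabla u+(\nabla u)^T)$. Let $C_\Gamma$ be a constant such that the trace operator on $\Gamma$ satisfies $\|\gamma(u)\|_{L^2(\Gamma)}\le C_\Gamma\|u\|_{W^{1,2}(\Omega)}$ for every $u\in W^{1,2}(\Omega)$; denote by $\gamma:W^{1,2}(\Omega;\mathbb{R}^n)\to L^2(\Gamma;\mathbb{R}^n)$ also the trace operator on vector valued functions. Let $\mathcal{R}$ be the space of infinitesimal rigid displacements, let $E:\gamma(\mathcal{R})\to\mathcal{R}$ be the inverse of the (one to one) restriction $\gamma|_{\mathcal{R}}$, let $\Pi:L^2(\Gamma;\mathbb{R}^n)\to\gamma(\mathcal{R})$ be the $L^2(\Gamma;\mathbb{R}^n)$-orthogonal projection onto $\gamma(\mathcal{R})$, and let $\rho=E\circ\Pi:L^2(\Gamma;\mathbb{R}^n)\to\mathcal{R}$. Then $$\|u-\rho(\gamma(u))\|_{W^{1,2}(\Omega)}\le (1+C_\Gamma\|E\|)K(1+Q^2)^{\frac12}\|\widehat\nabla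 u\|_{L^2(\Omega)}\quad\text{for every }u\in W^{1,2}(\Omega;\mathbb{R}^n),$$ where $\|E\|$ is the operator norm of $E$ from $\gamma(\mathcal{R})$, with the $L^2(\Gamma;\mathbb{R}^n)$-norm, to $W^{1,2}(\Omega;\mathbb{R}^n)$.
   Context: ''Open portion of $\partial\Omega$'' means a nonempty relatively open subset of $\partial\Omega$; $L^2(\Gamma)$ is taken with respect to the $(n-1)$-dimensional surface measure. A subscript $\Omega$ denotes the average over $\Omega$: $f_\Omega=\frac{1}{|\Omega|}\int_\Omega f$ (also for vector and matrix valued $f$). $\mathcal{R}=\{b+Mx \mid b\in\mathbb{R}^n,\ M\in\mathrm{Skew}^n\}$, where $\mathrm{Skew}^n$ is the set of skew-symmetric real $n\times n$ matrices. The restriction of $\gamma$ to $\mathcal{R}$ is injective, so $E$ is well defined. The gradient of $r(x)=b+Mx$ is $\nabla r=M$, i.e. $(\nabla u)_{ij}=\partial_j u_i$. Norms: $\|u\|_{W^{1,2}(\Omega)}=\left(\int_\Omega |u|^2+|\nabla u|^2\right)^{1/2}$, with the Euclidean (Frobenius) norm on vectors and matrices. The constants $Q$, $K$, $C_\Gamma$ exist by the classical Poincaré inequality, Korn inequality (of second kind) and trace theorem. *)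

(* Defs.v *)
From HB Require Import structures.
From mathcomp Require Import all_boot all_order all_algebra.
From mathcomp Require Import all_classical all_reals all_analysis.
From mathcomp Require Import zify.

Set Implicit Arguments.
Unset Strict Implicit.
Unset Printing Implicit Defensive.

Import Order.TTheory GRing.Theory Num.Theory.
Import numFieldNormedType.Exports.

Local Open Scope classical_set_scope.
Local Open Scope ring_scope.

(* The Borel sigma-algebra of R^n, generated by the coordinates as for tuples. *)
Section measurable_rV.
Context {R : realType}.
Variable n : nat.

Definition rV_coord (i : 'I_n) (x : 'rV[R]_n) : R := x ord0 i.

Let rV_set0 : g_sigma_preimage rV_coord set0.
Proof. exact: sigma_algebra0. Qed.

Let rV_setC A : g_sigma_preimage rV_coord A -> g_sigma_preimage rV_coord (~` A).
Proof. exact: sigma_algebraC. Qed.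

Let rV_bigcup (F : _^nat) : (forall i, g_sigma_preimage rV_coord (F i)) ->
  g_sigma_preimage rV_coord (\bigcup_i (F i)).
Proof. exact: sigma_algebra_bigcup. Qed.

HB.instance Definition _ := @isMeasurable.Build default_measure_display
  'rV[R]_n (g_sigma_preimage rV_coord) rV_set0 rV_setC rV_bigcup.

End measurable_rV.

Section measurable_fun_rV.
Context {R : realType}.

Lemma measurable_rV_coord n (i : 'I_n) :
  measurable_fun [set: 'rV[R]_n] (rV_coord i).
Proof.
move=> _ Y mY; rewrite setTI; apply: sub_sigma_algebra => /=.
rewrite -bigcup_seq/=; exists i => /=; first by rewrite mem_index_enum.
by exists Y => //; rewrite setTI.
Qed.

Lemma measurable_fun_rV d (T : measurableType d) n (f : T -> 'rV[R]_n) :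
  (forall i, measurable_fun setT (fun t => f t ord0 i)) ->
  measurable_fun setT f.
Proof.
move=> mf _ Y mY.
have : image_set_system setT f measurable Y; last by [].
move: Y mY; apply: smallest_sub.
  by apply: sigma_algebra_image; exact: sigma_algebra_measurable.
rewrite -bigcup_seq/= => A [i _ [B mB <-]].
by have := mf i measurableT B mB; rewrite /image_set_system/= !setTI.
Qed.

End measurable_fun_rV.

Section lebesgue_rV.
Context {R : realType}.

Definition rV_cons n (p : measurableTypeR R * 'rV[R]_n) : 'rV[R]_n.+1 :=
  \row_i (if unlift ord0 i is Some j then p.2 ord0 j else p.1).

Lemma rV_cons0 n p : @rV_cons n p ord0 ord0 = p.1.
Proof. by rewrite mxE unlift_none. Qed.

Lemma rV_consS n p (i : 'I_n) : @rV_cons n p ord0 (lift ord0 i) = p.2 ord0 i.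
Proof. by rewrite mxE liftK. Qed.

Lemma measurable_rV_cons n : measurable_fun setT (@rV_cons n).
Proof.
apply: measurable_fun_rV => i.
case: (unliftP ord0 i) => [j ->|->].
  rewrite (_ : (fun _ => _) = rV_coord j \o snd); last first.
    by apply/funext => p; rewrite rV_consS.
  by apply: measurableT_comp => //; exact: measurable_rV_coord.
rewrite (_ : (fun _ => _) = fst) //.
by apply/funext => p; rewrite rV_cons0.
Qed.

Definition rV_uncons n (x : 'rV[R]_n.+1) : measurableTypeR R * 'rV[R]_n :=
  (x ord0 ord0, \row_i x ord0 (lift ord0 i)).

Lemma rV_consK n : cancel (@rV_cons n) (@rV_uncons n).
Proof.
move=> [a y]; congr pair; first by rewrite rV_cons0.
by apply/rowP => i; rewrite mxE rV_consS.
Qed.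

Lemma measurable_rV_uncons n : measurable_fun setT (@rV_uncons n).
Proof.
apply: measurable_fun_pair; first exact: (measurable_rV_coord ord0).
apply: measurable_fun_rV => i; rewrite (_ : (fun _ => _) = rV_coord (lift ord0 i)).
  exact: measurable_rV_coord.
by apply/funext => x; rewrite mxE.
Qed.

Section lebesgue_rVS.
Variables (n : nat) (mu : {sigma_finite_measure set 'rV[R]_n -> \bar R}).

Definition lebesgue_rVS : set 'rV[R]_n.+1 -> \bar R :=
  pushforward (@lebesgue_measure R \x mu)%E (@rV_cons n).

HB.instance Definition _ := Measure.copy lebesgue_rVS
  (measure_function_pushforward__canonical__measure_function_Measure
    (@lebesgue_measure R \x mu)%E (@measurable_rV_cons n)).

Let lebesgue_rVS_sigma_finite : sigma_finite setT lebesgue_rVS.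
Proof.
have /sigma_finiteP[F [TF ndF Foo]] := sigma_finiteT (@lebesgue_measure R).
have /sigma_finiteP[G [TG ndG Goo]] := sigma_finiteT mu.
exists (fun k => @rV_uncons n @^-1` (F k `*` G k)).
  apply/esym; rewrite -subTset => x _.
  have [i _ Fi] : (\bigcup_i F i) (rV_uncons x).1 by rewrite -TF.
  have [j _ Gj] : (\bigcup_i G i) (rV_uncons x).2 by rewrite -TG.
  exists (maxn i j) => //; split.
  - by move: Fi; exact/subsetPset/ndF/leq_maxl.
  - by move: Gj; exact/subsetPset/ndG/leq_maxr.
move=> k; have [mF Fk] := Foo k; have [mG Gk] := Goo k; split.
  by rewrite -[X in measurable X]setTI; apply: measurable_rV_uncons => //;
    exact: measurableX.
rewrite /lebesgue_rVS /pushforward -comp_preimage.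
rewrite (_ : _ \o _ = id) ?preimage_id; last first.
  by apply/funext => p; exact: rV_consK.
by rewrite product_measure1E// lte_mul_pinfty// ge0_fin_numE.
Qed.

HB.instance Definition _ := Measure_isSigmaFinite.Build _ _ _ lebesgue_rVS
  lebesgue_rVS_sigma_finite.

End lebesgue_rVS.

(* R^0 is a point, and the measure on R^(n+1) = R x R^n is the product one. *)
Fixpoint lebesgue_rV n : {sigma_finite_measure set 'rV[R]_n -> \bar R} :=
  match n with
  | 0 => \d_ (0 : 'rV[R]_0)
  | n'.+1 => lebesgue_rVS (lebesgue_rV n')
  end.

End lebesgue_rV.

Section euclidean.
Context {R : realType}.

(* The library norm on matrices is the max norm; this one is Frobenius. *)
Definition frob_norm p q (A : 'M[R]_(p, q)) : R :=
  Num.sqrt (\sum_i \sum_j A i j ^+ 2).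

Lemma ler_coord_frob_norm n (x : 'rV[R]_n) i : `|x ord0 i| <= frob_norm x.
Proof.
rewrite -sqrtr_sqr ler_wsqrtr// big_ord1 (bigD1 i)//= lerDl.
by apply: sumr_ge0 => j _; exact: sqr_ge0.
Qed.

Definition unit_ball_volume n : R :=
  fine (lebesgue_rV n [set x : 'rV[R]_n | frob_norm x <= 1]).

End euclidean.

Section hausdorff.
Context {R : realType} {n : nat}.
Variable s : nat.
Local Notation T := 'rV[R]_n.
Local Open Scope ereal_scope.

Definition diameter (B : set T) : R :=
  sup [set frob_norm (x - y)%R | x in B & y in B].

(* The empty set is treated apart because of the convention 0 ^+ 0 = 1. *)
Definition hausdorff_gauge (delta : R) (B : set T) : \bar R :=
  if `[< B = set0 >] then 0
  else if `[< forall x y, B x -> B y -> (frob_norm (x - y) <= delta)%R >]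
  then (unit_ball_volume s * (diameter B / 2) ^+ s)%R%:E
  else +oo.

(* mu_ext only uses Borel covers, which does not change the measure as a set
   and its closure have the same diameter. *)
Definition hausdorff (A : set T) : \bar R :=
  ereal_sup [set mu_ext (hausdorff_gauge delta) A | delta in [set d : R | (0 < d)%R]].

Let gauge0 delta : hausdorff_gauge delta set0 = 0.
Proof. by rewrite /hausdorff_gauge asboolT. Qed.

Let gauge_ge0 delta B : 0 <= hausdorff_gauge delta B.
Proof.
rewrite /hausdorff_gauge; case: asboolP => // /eqP/set0P[x Bx].
case: asboolP => [dB|_]; last by rewrite leey.
rewrite lee_fin mulr_ge0 ?fine_ge0// exprn_ge0// divr_ge0//.
rewrite /diameter; apply: (@le_trans _ _ (frob_norm (x - x)%R)).
  exact: sqrtr_ge0.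
apply: ub_le_sup; last by exists x => //; exists x.
by exists delta => _ [y By] [z Bz] <-; exact: dB.
Qed.

Let gauge_anti d1 d2 B : (d1 <= d2)%R ->
  hausdorff_gauge d2 B <= hausdorff_gauge d1 B.
Proof.
move=> d12; rewrite /hausdorff_gauge; case: asboolP => // _.
case: (asboolP (forall x y, B x -> B y -> (frob_norm (x - y) <= d1)%R)) => [h1|_].
  by rewrite asboolT// => x y Bx By; rewrite (le_trans _ d12)// h1.
by rewrite leey.
Qed.

Let ext_ge0 delta A : 0 <= mu_ext (hausdorff_gauge delta) A.
Proof. exact: mu_ext_ge0. Qed.

Let ext_anti d1 d2 A : (d1 <= d2)%R ->
  mu_ext (hausdorff_gauge d2) A <= mu_ext (hausdorff_gauge d1) A.
Proof.
move=> d12; apply: le_ereal_inf_tmp => _ [F cF <-].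
apply: (@le_trans _ _ (\sum_(k <oo) hausdorff_gauge d2 (F k))).
  by apply: ereal_inf_lbound; exists F.
by apply: lee_nneseries => // k _; exact: gauge_anti.
Qed.

Let ext_le_hausdorff delta A : (0 < delta)%R ->
  mu_ext (hausdorff_gauge delta) A <= hausdorff A.
Proof. by move=> d0; apply: ereal_sup_ubound; exists delta. Qed.

Let hausdorff_out0 : hausdorff set0 = 0.
Proof.
apply/eqP; rewrite eq_le; apply/andP; split.
  by apply: ge_ereal_sup => _ [d _ <-]; rewrite mu_ext0.
by apply: le_trans (ext_le_hausdorff _ ltr01).
Qed.

Let hausdorff_out_ge0 A : 0 <= hausdorff A.
Proof. by apply: le_trans (ext_le_hausdorff _ ltr01). Qed.

Let le_hausdorff : {homo hausdorff : A B / A `<=` B >-> A <= B}.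
Proof.
move=> A B AB; apply: ge_ereal_sup => _ [d d0 <-].
by apply: le_trans (ext_le_hausdorff _ d0); exact: le_mu_ext.
Qed.

Let hausdorff_sigma_subadditive : sigma_subadditive hausdorff.
Proof.
move=> F; apply: ge_ereal_sup => _ [d d0 <-].
apply: (@le_trans _ _ (\sum_(i <oo) mu_ext (hausdorff_gauge d) (F i))).
  exact: mu_ext_sigma_subadditive.
by apply: lee_nneseries => // k _; exact: ext_le_hausdorff.
Qed.

HB.instance Definition _ := isOuterMeasure.Build R T hausdorff
  hausdorff_out0 hausdorff_out_ge0 le_hausdorff hausdorff_sigma_subadditive.

Let ext_separated d delta A B : (delta < d)%R ->
  (forall x y, A x -> B y -> (d <= frob_norm (x - y))%R) ->
  mu_ext (hausdorff_gauge delta) A + mu_ext (hausdorff_gauge delta) B <=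
  mu_ext (hausdorff_gauge delta) (A `|` B).
Proof.
move=> dd AB; apply: le_ereal_inf_tmp => _ [F [mF cF] <-].
pose G (C : set T) k := if `[< F k `&` C !=set0 >] then F k else set0.
have cG C : C `<=` A `|` B -> measurable_cover C (G C).
  move=> CAB; split=> [k|x Cx]; first by rewrite /G; case: asboolP.
  have [k _ Fkx] := cF _ (CAB _ Cx).
  by exists k => //; rewrite /G asboolT//; exists x.
apply: (@le_trans _ _ (\sum_(k <oo) hausdorff_gauge delta (G A k) +
                       \sum_(k <oo) hausdorff_gauge delta (G B k))).
  by apply: leeD; apply: ereal_inf_lbound; eexists=> //; apply: cG => x; [left|right].
rewrite -nneseriesD//; apply: lee_nneseries => [k _ _|k _]; first by rewrite adde_ge0.
rewrite /G; case: asboolP => [[x [Fx Ax]]|_]; last first.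
  by rewrite gauge0 add0e; case: asboolP => // _; rewrite gauge0.
case: asboolP => [[y [Fy By]]|_]; last by rewrite gauge0 adde0.
rewrite [leRHS]/hausdorff_gauge asboolF; last by move=> F0; rewrite F0 in Fx.
rewrite asboolF ?leey// => /(_ _ _ Fx Fy); apply/negP; rewrite -ltNge.
exact: lt_le_trans (AB _ _ Ax By).
Qed.

Let hausdorff_separated d A B : (0 < d)%R ->
  (forall x y, A x -> B y -> (d <= frob_norm (x - y))%R) ->
  hausdorff A + hausdorff B <= hausdorff (A `|` B).
Proof.
move=> d0 AB; set X := hausdorff (A `|` B).
have key d1 d2 : (0 < d1)%R -> (0 < d2)%R ->
    mu_ext (hausdorff_gauge d1) A + mu_ext (hausdorff_gauge d2) B <= X.
  move=> d10 d20; pose e := Num.min (d / 2)%R (Num.min d1 d2).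
  have e0 : (0 < e)%R by rewrite !lt_min d10 d20 divr_gt0.
  apply: le_trans (ext_le_hausdorff _ e0); apply: le_trans (ext_separated _ AB).
    by apply: leeD; apply: ext_anti; rewrite !ge_min lexx ?orbT.
  by rewrite gt_min ltr_pdivrMr// ltr_pMr// ltr1n.
have [Xoo|Xfin] := eqVneq X +oo; first by rewrite Xoo leey.
have finP C d1 : (0 < d1)%R -> mu_ext (hausdorff_gauge d1) C <= X ->
    mu_ext (hausdorff_gauge d1) C \is a fin_num.
  by move=> d10 CX; rewrite ge0_fin_numE// (le_lt_trans CX)// ltey.
have finA d1 : (0 < d1)%R -> mu_ext (hausdorff_gauge d1) A \is a fin_num.
  by move=> d10; apply: finP => //; apply: le_trans (key d1 d1 d10 d10); rewrite leeDl.
have AX d2 : (0 < d2)%R -> hausdorff A + mu_ext (hausdorff_gauge d2) B <= X.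
  move=> d20.
  have finB : mu_ext (hausdorff_gauge d2) B \is a fin_num.
    by apply: finP => //; apply: le_trans (key d2 d2 d20 d20); rewrite leeDr.
  rewrite -leeBrDr//; apply: ge_ereal_sup => _ [d1 d10 <-].
  by rewrite leeBrDr// key.
have finHA : hausdorff A \is a fin_num.
  rewrite ge0_fin_numE//; apply: le_lt_trans (_ : X < +oo); last by rewrite ltey.
  by apply: le_trans (AX _ ltr01); rewrite leeDl.
rewrite addeC -leeBrDr//; apply: ge_ereal_sup => _ [d2 d20 <-].
by rewrite leeBrDr// addeC AX.
Qed.

Section coordinate.
Variables (i : 'I_n) (a : R) (X : set T).
Hypothesis Xfin : hausdorff X < +oo.

Let slice (b c : R) := X `&` [set x | (b <= x ord0 i < c)%R].
Let r (k : nat) : R := (a + k.+1%:R^-1)%R.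
Let D k := slice (r k.+1) (r k).

Let r_lt k l : (k < l)%N -> (r l < r k)%R.
Proof. by move=> kl; rewrite ltrD2l ltf_pV2 ?posrE ?ltr_nat. Qed.

Let r_le k l : (k <= l)%N -> (r l <= r k)%R.
Proof. by move=> kl; rewrite lerD2l lef_pV2 ?posrE ?ler_nat. Qed.

Let sep (d b : R) (A B : set T) : (0 < d)%R ->
  (forall x, A x -> (b + d <= x ord0 i)%R) -> (forall x, B x -> (x ord0 i <= b)%R) ->
  hausdorff A + hausdorff B <= hausdorff (A `|` B).
Proof.
move=> d0 hA hB; apply: (hausdorff_separated d0) => x y /hA Ax /hB By.
apply: le_trans (ler_coord_frob_norm _ i); rewrite !mxE.
apply: le_trans (ler_norm _); rewrite lerBrDr; apply: le_trans Ax.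
by rewrite addrC lerD2r.
Qed.

Let sum_slices p m :
  \sum_(k < m) hausdorff (D (2 * k + p)%N) <=
  hausdorff (X `&` [set x | (r (2 * m + p).-1 <= x ord0 i)%R]).
Proof.
elim: m => [|m ih]; first by rewrite big_ord0.
rewrite big_ord_recr/=; have [m0|m0] := posnP m.
  subst m; rewrite big_ord0 add0e; apply: le_hausdorff.
  by move=> x [Xx /andP[h _]]; split => //=; apply: le_trans h; apply: r_le; lia.
apply: le_trans (leeD2r _ ih) _.
have rr : (0 < r (2 * m + p).-1 - r (2 * m + p))%R.
  by rewrite subr_gt0; apply: r_lt; lia.
apply: le_trans (@sep _ (r (2 * m + p)) _ _ rr (_ : forall x, _ -> _) (_ : forall x, _ -> _)) _.
- by move=> x [_ /= h]; rewrite addrC subrK; exact: h.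
- by move=> x [_ /andP[_ /ltW]].
- apply: le_hausdorff => x [[Xx /= h]|[Xx /andP[h _]]]; split => //=.
  + by apply: le_trans h; apply: r_le; lia.
  + by apply: le_trans h; apply: r_le; lia.
Qed.

Let E k := slice (r (2 * k + 2)) (r (2 * k)).

Let sum_E : \sum_(k <oo) hausdorff (E k) < +oo.
Proof.
apply: (@le_lt_trans _ _ (hausdorff X + hausdorff X)); last by rewrite lte_add_pinfty.
apply: lime_le; first by apply: is_cvg_nneseries.
apply: nearW => m; rewrite big_mkord.
apply: (@le_trans _ _ (\sum_(k < m) hausdorff (D (2 * k + 0)%N) +
                       \sum_(k < m) hausdorff (D (2 * k + 1)%N))).
  rewrite -big_split/=; apply: lee_sum => k _.
  apply: le_trans (outer_measureU2 hausdorff _ _); apply: le_hausdorff.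
  move=> x [Xx /= /andP[h1 h2]].
  have [h|h] := ltP (x ord0 i) (r (2 * k + 1)).
    right; split => //=; rewrite h andbT.
    by apply: le_trans h1; apply: r_le; lia.
  left; split => //=; rewrite -addn1 addn0 h2 andbT.
  exact: h.
by apply: leeD; apply: le_trans (sum_slices _ _) _; apply: le_hausdorff => x [].
Qed.

Lemma hausdorff_halfspace :
  hausdorff (X `&` [set x | (a < x ord0 i)%R]) +
  hausdorff (X `&` ~` [set x | (a < x ord0 i)%R]) <= hausdorff X.
Proof.
set A := X `&` _; set B := X `&` _.
apply/lee_addgt0Pr => e e0.
have /fine_cvgP[_ /cvgrPdist_lt /(_ _ e0)] :=
  nneseries_tail_cvg sum_E (fun k _ => hausdorff_out_ge0 (E k)).
move=> [m _ /(_ m (leqnn m))]; rewrite /= sub0r normrN => tm.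
pose tail := \sum_(m <= k <oo) hausdorff (E k).
have tail0 : 0 <= tail by exact: nneseries_ge0.
have tailfin : tail \is a fin_num.
  rewrite ge0_fin_numE//; apply: le_lt_trans sum_E.
  rewrite (@nneseries_split _ _ 0 m)// add0n leeDr//.
  by apply: sume_ge0.
have taile : tail <= e%:E.
  by rewrite -(fineK tailfin) lee_fin (le_trans (ler_norm _))// ltW.
pose Am := X `&` [set x | (r (2 * m) <= x ord0 i)%R].
have HA : hausdorff A <= hausdorff Am + tail.
  apply: (@le_trans _ _ (hausdorff (Am `|` \bigcup_(k in ~` `I_m) E k))).
    apply: le_hausdorff => x [Xx /= ax].
    have [h|h] := leP (r (2 * m)) (x ord0 i); first by left.
    right; have xa0 : (0 < x ord0 i - a)%R by rewrite subr_gt0.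
    have ex : exists k, (r (2 * k + 2) <= x ord0 i)%R.
      have [N _ hN] := near_infty_natSinv_lt (PosNum xa0).
      exists N; rewrite /r addrC -lerBrDr ltW//.
      by apply: (hN (2 * N + 2)%N) => /=; rewrite mul2n -addnn -addnA leq_addr.
    case: (ex_minnP ex) => k hk kmin.
    have mk : (m <= k)%N.
      rewrite leqNgt; apply/negP => km.
      have km2 : (2 * k + 2 <= 2 * m)%N by rewrite addnC -mulnS leq_mul2l.
      by have := lt_le_trans h (le_trans (r_le km2) hk); rewrite ltxx.
    exists k; first by apply/negP; rewrite -leqNgt.
    split => //=; rewrite hk/=; rewrite ltNge; apply/negP => hk'.
    have [k0|k0] := posnP k.
      have m0 : m = 0%N by move: mk; rewrite k0 leqn0 => /eqP.
      by move: h hk'; rewrite m0 k0 ltNge => /negP.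
    have := kmin k.-1; rewrite addnC -mulnS prednK//.
    by move=> /(_ hk'); rewrite leqNgt ltn_predL k0.
  apply: le_trans (outer_measureU2 hausdorff _ _) _; rewrite leeD2l//.
  exact: outer_measure_sigma_subadditive_tail.
apply: (@le_trans _ _ ((hausdorff Am + hausdorff B) + tail)).
  by rewrite addeAC leeD2r.
apply: leeD => //.
have rm : (0 < r (2 * m) - a)%R by rewrite /r addrC addKr invr_gt0.
apply: le_trans (@sep _ a _ _ rm (_ : forall x, _ -> _) (_ : forall x, _ -> _)) _.
- by move=> x [_ /= h]; rewrite addrC subrK; exact: h.
- by move=> x [_ /= /negP]; rewrite -leNgt.
- by apply: le_hausdorff => x [[]|[]].
Qed.

End coordinate.

Lemma measurable_hausdorff_caratheodory (A : set T) :
  measurable A -> caratheodory_measurable hausdorff A.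
Proof.
have sC : sigma_algebra setT (caratheodory_measurable hausdorff).
  split; first exact: caratheodory_measurable_set0.
  - by move=> B; rewrite setTD; exact: caratheodory_measurable_setC.
  - exact: caratheodory_measurable_bigcup.
move: A; apply: smallest_sub => //; rewrite -bigcup_seq => _ [i _ [B mB <-]].
suff : image_set_system setT (rV_coord i) (caratheodory_measurable hausdorff) B by [].
move: B mB; rewrite /measurable/= /measurableR measurable_realfun.RGenOInfty.measurableE.
apply: smallest_sub; first exact: sigma_algebra_image.
move=> _ [a ->]; rewrite /image_set_system/= setTI.
have -> : rV_coord i @^-1` `]a, +oo[ = [set x : T | (a < x ord0 i)%R].
  by apply/seteqP; split => x /=; rewrite in_itv/= andbT.
apply: le_caratheodory_measurable => X.
have [Xoo|Xoo] := eqVneq (hausdorff X) +oo; first by rewrite [leRHS]Xoo leey.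
by apply: hausdorff_halfspace; rewrite ltey.
Qed.

Let hausdorff_sigma_additive : semi_sigma_additive hausdorff.
Proof.
move=> F mF tF mUF; apply: caratheodory_measure_sigma_additive => //.
- by move=> k; exact: measurable_hausdorff_caratheodory.
- exact: measurable_hausdorff_caratheodory.
Qed.

HB.instance Definition _ := isMeasure.Build _ _ _ hausdorff
  hausdorff_out0 hausdorff_out_ge0 hausdorff_sigma_additive.

End hausdorff.

Section domains.
Context {R : realType}.

Definition boundary (T : topologicalType) (A : set T) : set T :=
  closure A `\` A^°.

Definition open_portion (T : topologicalType) (B G : set T) : Prop :=
  G !=set0 /\ exists2 U, open U & G = U `&` B.

(* Locally, and up to an orthogonal change of coordinates, Omega lies above the
   graph of a Lipschitz function; the vertical coordinate is the first one. *)
Definition lipschitz_boundary n (Omega : set 'rV[R]_n.+1) : Prop :=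
  forall x0, boundary Omega x0 ->
  exists (r : R) (A : 'M[R]_n.+1) (g : 'rV[R]_n -> R) (L : R),
    [/\ 0 < r, A *m A^T = 1%:M,
        forall y z, `|g y - g z| <= L * frob_norm (y - z) &
        forall x, frob_norm (x - x0) < r ->
          Omega x <-> g (col' ord0 (x *m A)) < (x *m A) ord0 ord0].

End domains.

Section square_integrable.
Context d (T : measurableType d) (R : realType).
Variables (mu : {measure set T -> \bar R}) (D : set T).

Definition L2 (f : T -> R) : Prop :=
  measurable_fun D f /\ (\int[mu]_(x in D) (f x ^+ 2)%:E < +oo)%E.

Definition L2_norm (f : T -> R) : R := Num.sqrt (\int[mu]_(x in D) (f x ^+ 2)).

Definition L2V p (f : T -> 'rV[R]_p) : Prop :=
  forall i, L2 (fun x => f x ord0 i).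

Definition L2M_norm p q (f : T -> 'M[R]_(p, q)) : R :=
  L2_norm (fun x => frob_norm (f x)).

Definition L2V_inner p (f g : T -> 'rV[R]_p) : R :=
  \int[mu]_(x in D) (\sum_i f x ord0 i * g x ord0 i).

Definition mean (f : T -> R) : R := (\int[mu]_(x in D) f x) / fine (mu D).

Definition meanM p q (f : T -> 'M[R]_(p, q)) : 'M[R]_(p, q) :=
  \matrix_(i, j) mean (fun x => f x i j).

End square_integrable.

Section sobolev.
Context {R : realType} {n : nat}.
Local Notation T := 'rV[R]_n.

Definition partial (j : 'I_n) (f : T -> R) : T -> R :=
  'D_(delta_mx ord0 j) f.

Fixpoint Ck (k : nat) (f : T -> R) : Prop :=
  match k with
  | 0 => continuous f
  | k'.+1 => (forall j x, derivable f x (delta_mx ord0 j)) /\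
             (forall j, Ck k' (partial j f))
  end.

Variable Omega : set T.
Local Notation lambda := (lebesgue_rV n).

Definition test_function (phi : T -> R) : Prop :=
  (forall k, Ck k phi) /\
  exists K, [/\ compact K, K `<=` Omega & forall x, ~ K x -> phi x = 0].

(* W12 Omega u G: u belongs to W^{1,2}(Omega), and G is its weak gradient (or
   any other representative of it). *)
Definition W12 (u : T -> R) (G : T -> 'rV[R]_n) : Prop :=
  [/\ L2 lambda Omega u, L2V lambda Omega G &
      forall j phi, test_function phi ->
        \int[lambda]_(x in Omega) (u x * partial j phi x) =
        - \int[lambda]_(x in Omega) (G x ord0 j * phi x)].

Definition W12_norm (u : T -> R) (G : T -> 'rV[R]_n) : R :=
  Num.sqrt (\int[lambda]_(x in Omega) (u x ^+ 2 + frob_norm (G x) ^+ 2)).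

(* Row i of G is the gradient of the i-th component. *)
Definition W12V p (u : T -> 'rV[R]_p) (G : T -> 'M[R]_(p, n)) : Prop :=
  forall i, W12 (fun x => u x ord0 i) (fun x => row i (G x)).

Definition W12V_norm p (u : T -> 'rV[R]_p) (G : T -> 'M[R]_(p, n)) : R :=
  Num.sqrt (\int[lambda]_(x in Omega)
    (frob_norm (u x) ^+ 2 + frob_norm (G x) ^+ 2)).

End sobolev.

Section rigid.
Context {R : realType} {n : nat}.

Definition symM (A : 'M[R]_n) : 'M[R]_n := 2^-1 *: (A + A^T).
Definition skewM (A : 'M[R]_n) : 'M[R]_n := 2^-1 *: (A - A^T).

(* x |-> b + M x, in row vector form *)
Definition rigid : set ('rV[R]_n -> 'rV[R]_n) :=
  [set r | exists b M, M^T = - M /\ r = fun x => b + x *m M^T].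

Definition gradient (r : 'rV[R]_n -> 'rV[R]_n) (x : 'rV[R]_n) : 'M[R]_n :=
  \matrix_(i, j) partial j (fun y => r y ord0 i) x.

End rigid.

Section trace.
Context {R : realType} {n : nat}.
Local Notation T := 'rV[R]_n.+1.
Variables Omega Gamma : set T.
Local Notation sigma := (@hausdorff R n.+1 n).

(* The trace operator is the bounded linear map from W^{1,2}(Omega) to
   L^2(Gamma) that restricts functions which are continuous up to the boundary;
   as usual, the identities in L^2(Gamma) hold almost everywhere. *)
Definition is_trace (gamma : (T -> R) -> T -> R) : Prop :=
  [/\ forall u G, W12 Omega u G -> L2 sigma Gamma (gamma u),
      forall a b u v Gu Gv, W12 Omega u Gu -> W12 Omega v Gv ->
        gamma (fun x => a * u x + b * v x) =
          (fun x => a * gamma u x + b * gamma v x) %[ae sigma in Gamma],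
      exists C, forall u G, W12 Omega u G ->
        L2_norm sigma Gamma (gamma u) <= C * W12_norm Omega u G &
      forall u G, W12 Omega u G -> {within closure Omega, continuous u} ->
        gamma u = u %[ae sigma in Gamma]].

Variable gamma : (T -> R) -> T -> R.

Definition traceV (u : T -> T) (x : T) : T :=
  \row_i gamma (fun y => u y ord0 i) x.

(* gamma(R), as a set of representatives of elements of L^2(Gamma; R^n) *)
Definition trace_rigid : set (T -> T) :=
  [set g | L2V sigma Gamma g /\
           exists2 r, rigid r & g = traceV r %[ae sigma in Gamma]].

Definition trace_rigid_inverse (E : (T -> T) -> T -> T) : Prop :=
  forall r g, rigid r -> L2V sigma Gamma g ->
    g = traceV r %[ae sigma in Gamma] -> E g = r.

Definition trace_rigid_projection (P : (T -> T) -> T -> T) : Prop :=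
  forall g, L2V sigma Gamma g -> trace_rigid (P g) /\
    forall h, trace_rigid h ->
      L2V_inner sigma Gamma (fun x => g x - P g x) h = 0.

Definition op_norm (E : (T -> T) -> T -> T) : R :=
  sup [set W12V_norm Omega (E g) (gradient (E g)) |
       g in [set g | trace_rigid g /\ L2M_norm sigma Gamma g <= 1]].

End trace.

(* Main.v *)
(** Korn's inequality for [u], followed by Poincare's inequality for the
    components of [u - M x], where [M] is the skew part of the mean of the
    gradient, produces a rigid [w] with
    [|u - w| <= K (1 + Q^2)^(1/2) |sym (grad u)|] in [W^{1,2}].  As
    [w = rho (gamma w)] and the projection is a contraction,
    [|w - rho (gamma u)| <= |E| |gamma (w - u)| <= C |E| |u - w|].
    Two facts are implicit in this argument.  Affine functions belong to
    [W^{1,2}], their weak gradient being computed by Fubini and the fundamental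
    theorem of calculus.  The supremum defining [|E|] is finite: on the
    finite-dimensional space of rigid displacements the [L^2] norm of the trace
    vanishes only at 0, since [E] inverts the trace, and hence controls the
    [W^{1,2}] norm. *)

Require Import Defs.
From HB Require Import structures.
From mathcomp Require Import all_boot all_order all_algebra.
From mathcomp Require Import all_classical all_reals all_analysis.
From mathcomp Require Import measurable_realfun.
From mathcomp Require Import ring lra.
Set Implicit Arguments.
Unset Strict Implicit.
Unset Printing Implicit Defensive.
Import Order.TTheory GRing.Theory Num.Theory.
Import numFieldNormedType.Exports.
Local Open Scope classical_set_scope.
Local Open Scope ring_scope.

(** * Borel sets, cubes and bounded sets in [R^n] *)

Section measure_rV.
Context {R : realType}.

(** The sigma-algebra is generated by the coordinates, so openness is reduced to countably many
    coordinate conditions: an open set is the union of the open cubes it contains with rational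
    centre and radius [k.+1%:R^-1]. *)
Lemma measurable_open_rV n (U : set 'rV[R]_n) : open U -> measurable U.
Proof.
move=> oU; pose box (p : 'rV[rat]_n * nat) : set 'rV[R]_n :=
  [set x | forall i, `|x ord0 i - ratr (p.1 ord0 i)| < p.2.+1%:R^-1].
have mbox p : measurable (box p).
  rewrite (_ : box p = \bigcap_(i in [set: 'I_n])
      [set x : 'rV[R]_n | `|x ord0 i - ratr (p.1 ord0 i)| < p.2.+1%:R^-1]); last first.
    by apply/seteqP; split => x /= h i; [move=> _; exact: h|exact: h].
  apply: fin_bigcap_measurable => // i _.
  have := @measurable_rV_coord R n i measurableT _ (measurable_itv
     `](ratr (p.1 ord0 i) - p.2.+1%:R^-1), (ratr (p.1 ord0 i) + p.2.+1%:R^-1)[).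
  rewrite setTI; congr measurable; apply/seteqP; split => x /=;
  by rewrite in_itv/= ltr_distl.
rewrite (_ : U = \bigcup_p (if `[< box p `<=` U >] then box p else set0)); last first.
  apply/seteqP; split => x; last by move=> [p _]; case: asboolP => // pU /pU.
  move=> Ux; move/open_nbhs_nbhs : (conj oU Ux) => /nbhs_ballP[e /= e0 xeU].
  (* A cube of radius below [e / 2] that contains [x] stays within the max-norm ball of radius [e]
     around [x]. *)
  have e20 : 0 < e / 2 by rewrite divr_gt0.
  have [k _ /(_ k (leqnn k)) ke] := near_infty_natSinv_lt (PosNum e20).
  have /choice[q qx] : forall i : 'I_n, exists q : rat, `|x ord0 i - ratr q| < k.+1%:R^-1.
    move=> i; have k0 : x ord0 i - k.+1%:R^-1 < x ord0 i + k.+1%:R^-1.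
      by rewrite ltrD2l gtrN// invr_gt0.
    have [q] := rat_in_itvoo k0; rewrite in_itv/= => qk; exists q.
    by rewrite distrC ltr_distl.
  exists (\row_i q i, k) => //=; rewrite asboolT; first by move=> i /=; rewrite mxE.
  move=> y By; apply: xeU; split => // i j; rewrite (ord1 i) /ball/=.
  rewrite (_ : _ - _ = (x ord0 j - ratr (q j)) - (y ord0 j - ratr (q j))); last first.
    by rewrite opprB addrA subrK.
  rewrite (le_lt_trans (ler_normB _ _))// [e]splitr ltrD//.
    exact: lt_trans (qx j) ke.
  by have := By j; rewrite /= mxE => /lt_trans; apply.
apply: countable_bigcupT_measurable => [|p]; last by case: asboolP.
exact: countableP.
Qed.

Lemma measurable_closed_rV n (A : set 'rV[R]_n) : closed A -> measurable A.
Proof.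
move=> cA; rewrite -[A]setCK; apply: measurableC; apply: measurable_open_rV.
exact: closed_openC.
Qed.

Lemma continuous_measurable_rV n (f : 'rV[R]_n -> R) :
  continuous f -> measurable_fun setT f.
Proof.
move=> cf; apply: (measurability _ (RGenOpens.measurableE R)) => //.
move=> _ [_ [a [b ->] <-]]; rewrite setTI.
apply: measurable_open_rV; move/continuousP : cf; apply.
exact: interval_open.
Qed.

(** A cube splits as a product along the first coordinate, which a Euclidean ball does not;
    inductions on the dimension rely on this. *)
Definition box n (B : R) : set 'rV[R]_n := [set x | forall i, `|x ord0 i| <= B].

Lemma measurable_box n B : measurable (@box n B).
Proof.
rewrite (_ : box B = \bigcap_(i in [set: 'I_n])
    [set x : 'rV[R]_n | `|x ord0 i| <= B]); last first.
  by apply/seteqP; split => x /= h i; [move=> _; exact: h|exact: h].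
apply: fin_bigcap_measurable => // i _.
have := @measurable_rV_coord R n i measurableT _ (measurable_itv `[(- B), B]).
by rewrite setTI; congr measurable; apply/seteqP; split => x /=;
  rewrite in_itv/= ler_norml.
Qed.

Lemma compact_box n B : compact (@box n B).
Proof.
rewrite (_ : box B = [set v : 'rV[R]_n | forall i, `[(- B), B]%classic (v ord0 i)]).
  by apply: (@rV_compact _ n (fun _ => `[(- B), B]%classic)) => i; exact: segment_compact.
by apply/seteqP; split => x /= h i; have := h i; rewrite in_itv/= ler_norml.
Qed.

Lemma lebesgue_rV_box n B : (lebesgue_rV n (@box n B) < +oo)%E.
Proof.
elim: n => [|n ih] /=.
  by rewrite diracE ltry.
rewrite /lebesgue_rVS/= /pushforward.
rewrite (_ : _ @^-1` _ = `[(- B), B] `*` @box n B); last first.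
  apply/seteqP; split => [[t y] h|[t y] [/= h1 h2]] /=.
    split=> /=; first by have := h ord0; rewrite rV_cons0 in_itv/= ler_norml.
    by move=> i; have := h (lift ord0 i); rewrite rV_consS.
  move=> i; case: (unliftP ord0 i) => [j ->|->].
    by rewrite rV_consS.
  by rewrite rV_cons0 ler_norml; move: h1; rewrite in_itv.
rewrite product_measure1E//; last exact: measurable_box.
rewrite lte_mul_pinfty// ?ge0_fin_numE//.
by rewrite /= lebesgue_measure_itv/=; case: ifP => _; rewrite ltry.
Qed.

Lemma bounded_set_box n (A : set 'rV[R]_n) :
  bounded_set A -> exists2 B, 0 < B & A `<=` box B.
Proof.
(* Boundedness is given for thresholds strictly above [M], hence [M + 1]; the maximum with 1 makes
   the half-side positive. *)
move=> [M [_ hM]]; exists (Num.max 1 (M + 1)); first by rewrite lt_max ltr01.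
move=> x Ax i; have := hM (Num.max 1 (M + 1)).
rewrite lt_max ltrDl ltr01 orbT => /(_ isT x Ax); apply: le_trans.
rewrite [`|x|]mx_normrE.
by apply: (le_bigmax _ (fun i : 'I_1 * 'I_n => `|x i.1 i.2|) (ord0, i)).
Qed.

Lemma lebesgue_rV_bounded n (A : set 'rV[R]_n) :
  measurable A -> bounded_set A -> (lebesgue_rV n A < +oo)%E.
Proof.
move=> mA /bounded_set_box[B _ AB]; apply: le_lt_trans (lebesgue_rV_box n B).
by apply: le_measure => //; rewrite inE//; exact: measurable_box.
Qed.

Lemma continuous_box_bounded n (f : 'rV[R]_n -> R) B : continuous f ->
  (forall x, ~ box B x -> f x = 0) -> exists2 M, 0 <= M & forall x, `|f x| <= M.
Proof.
move=> cf f0.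
have : compact (f @` box B).
  by apply: continuous_compact (@compact_box n B); exact: continuous_subspaceT.
move=> /compact_bounded[M [_ hM]]; exists (Num.max 0 (M + 1)).
  by rewrite le_max lexx.
move=> x; have [bx|bx] := pselect (box B x).
  apply: hM; last by exists x.
  by rewrite lt_max ltrDl ltr01 orbT.
by rewrite f0// normr0 le_max lexx.
Qed.

Lemma bounded_integrable d (T : measurableType d) (mu : {measure set T -> \bar R})
    (D : set T) (f : T -> R) M :
  measurable D -> (mu D < +oo)%E -> measurable_fun D f ->
  (forall x, D x -> `|f x| <= M) -> mu.-integrable D (EFin \o f).
Proof.
move=> mD Dfin mf fM; apply: measurable_bounded_integrable => //.
exists M; split; rewrite ?num_real// => x Mx y Dy /=.
exact: le_trans (fM y Dy) (ltW Mx).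
Qed.

Lemma continuous_box_integrable n (f : 'rV[R]_n -> R) B : continuous f ->
  (forall x, ~ box B x -> f x = 0) ->
  (lebesgue_rV n).-integrable setT (EFin \o f).
Proof.
move=> cf f0; have [M M0 fM] := continuous_box_bounded cf f0.
have mf := continuous_measurable_rV cf.
have : (lebesgue_rV n).-integrable (box B) (EFin \o f).
  apply: (bounded_integrable (M := M)); first exact: measurable_box.
  - exact: lebesgue_rV_box.
  - exact: measurable_funTS.
  - by move=> x _.
move/(integrable_mkcond (EFin \o f) (measurable_box B)).
congr (_.-integrable _ _); apply/funext => x; rewrite patchE.
by case: ifPn => //; rewrite notin_setE => /f0 /= ->.
Qed.

End measure_rV.

(** * Fubini and the vanishing of integrals of partial derivatives *)

Section weak_derivative.
Context {R : realType}.

Lemma continuous_rV (X : topologicalType) n (f : X -> 'rV[R]_n) :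
  (forall i, continuous (fun x => f x ord0 i)) -> continuous f.
Proof.
move=> cf x A [P hP sPA].
have : \forall y \near x, forall j, P ord0 j (f y ord0 j).
  by apply: filter_forall => j; apply: cf; exact: hP.
by apply: filterS => y Py; apply: sPA => i j; rewrite (ord1 i).
Qed.

Lemma rV_cons_head n (t h : R) (y : 'rV[R]_n) :
  h *: delta_mx ord0 ord0 + rV_cons (t, y) = rV_cons (h + t, y).
Proof.
apply/rowP => i; case: (unliftP ord0 i) => [j ->|->].
  by rewrite 2!mxE !rV_consS mxE /= mulr0 add0r.
by rewrite 2!mxE !rV_cons0 mxE !eqxx mulr1.
Qed.

Lemma rV_cons_tail n (t h : R) (y : 'rV[R]_n) (j : 'I_n) :
  h *: delta_mx ord0 (lift ord0 j) + rV_cons (t, y) =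
  rV_cons (t, h *: delta_mx ord0 j + y).
Proof.
apply/rowP => i; case: (unliftP ord0 i) => [k ->|->].
  by rewrite 2!mxE !rV_consS !mxE (inj_eq (@lift_inj _ _)).
by rewrite 2!mxE !rV_cons0 mxE /= mulr0 add0r.
Qed.

Lemma continuous_rV_cons_head n (y : 'rV[R]_n) :
  continuous (fun t : R => rV_cons (t, y)).
Proof.
apply: continuous_rV => i; case: (unliftP ord0 i) => [j ->|->] t.
  by under eq_fun do rewrite rV_consS; exact: cst_continuous.
by under eq_fun do rewrite rV_cons0; exact: cvg_id.
Qed.

Lemma continuous_rV_cons_tail n (t : R) :
  continuous (fun y : 'rV[R]_n => rV_cons (t, y)).
Proof.
apply: continuous_rV => i; case: (unliftP ord0 i) => [j ->|->] y.
  by under eq_fun do rewrite rV_consS; exact: coord_continuous.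
by under eq_fun do rewrite rV_cons0; exact: cst_continuous.
Qed.

(** A directional derivative sees only the restriction to a line: the two difference quotients
    coincide as functions of [h], the base values agreeing by the case [h = 0]. This carries partial
    derivatives through [rV_cons]. *)
Lemma derive_line_eq (V W : normedModType R) (f : V -> R) (g : W -> R) a b v w :
  (forall h : R, f (h *: v + a) = g (h *: w + b)) ->
  'D_v f a = 'D_w g b /\ (derivable f a v -> derivable g b w).
Proof.
move=> fg; have fagb : f a = g b by have := fg 0; rewrite !scale0r !add0r.
have E : (fun h : R => h^-1 *: ((f \o shift a) (h *: v) - f a)) =
    (fun h : R => h^-1 *: ((g \o shift b) (h *: w) - g b)).
  by apply/funext => h /=; rewrite fagb fg.
by rewrite /derive /derivable E.
Qed.

Lemma partial_eq0 n (j : 'I_n) (f : 'rV[R]_n -> R) (K : set 'rV[R]_n) x :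
  closed K -> (forall y, ~ K y -> f y = 0) -> ~ K x -> partial j f x = 0.
Proof.
move=> cK f0 Kx; rewrite /partial -[RHS](@derive_cst R 'rV[R]_n R 0 x (delta_mx ord0 j)).
apply: near_eq_derive.
have : nbhs x (~` K) by apply: open_nbhs_nbhs; split => //; exact: closed_openC.
by apply: filterS => y /f0.
Qed.

Lemma closed_box n B : closed (@box R n B).
Proof.
by apply: compact_closed; [exact: norm_hausdorff|exact: compact_box].
Qed.

Lemma integrable_rV_cons n (f : 'rV[R]_n.+1 -> R) :
  (lebesgue_rV n.+1).-integrable setT (EFin \o f) ->
  (@lebesgue_measure R \x lebesgue_rV n)%E.-integrable setT
    (EFin \o (f \o @rV_cons R n)).
Proof.
move=> /integrableP[mf foo]; apply/integrableP; split.
  exact: (measurableT_comp mf (@measurable_rV_cons R n)).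
move: foo; rewrite /= /lebesgue_rVS ge0_integral_pushforward//.
- exact: measurable_rV_cons.
- exact: (measurableT_comp (@abse_measurable R setT) mf).
Qed.

Lemma integral_rV_cons n (f : 'rV[R]_n.+1 -> R) :
  (lebesgue_rV n.+1).-integrable setT (EFin \o f) ->
  (\int[lebesgue_rV n.+1]_x (f x)%:E =
   \int[(@lebesgue_measure R \x lebesgue_rV n)]_z (f (rV_cons z))%:E)%E.
Proof.
move=> intf; have mf : measurable_fun setT (EFin \o f) by case/integrableP : intf.
rewrite /= /lebesgue_rVS (integral_pushforward (@measurable_rV_cons R n) mf)//.
exact: integrable_rV_cons.
Qed.

(** The fundamental theorem of calculus on an interval whose ends lie beyond the support of [F]. *)
Lemma integral_derive_box (F f : R -> R) (B : R) : 0 < B ->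
  (forall t, derivable F t 1) -> (forall t, derive1 F t = f t) -> continuous f ->
  (forall t, B < `|t| -> F t = 0) ->
  (\int[lebesgue_measure]_t (f t)%:E = 0)%E.
Proof.
move=> B0 dF Ff cf F0.
have f0 t : B < `|t| -> f t = 0.
  move=> Bt; rewrite -Ff derive1E -[RHS](@derive_cst R R R 0 t 1).
  apply: near_eq_derive.
  have : nbhs t [set u : R | B < `|u|].
    apply: open_nbhs_nbhs; split => //.
    rewrite (_ : mkset _ = (@Num.norm R R) @^-1` `]B, +oo[%classic); last first.
      by apply/seteqP; split => u /=; rewrite in_itv/= andbT.
    by apply: open_comp => [u _|]; [exact: norm_continuous|exact: interval_open].
  by apply: filterS => u /F0.
have cF : continuous F.
  by move=> t; apply: differentiable_continuous; apply/derivable1_diffP; exact: dF.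
(* The interval is enlarged by 1 because [F] is assumed to vanish only strictly beyond [B]. *)
have BB : - (B + 1) < B + 1 by rewrite gtrN// addr_gt0.
have FB : F (B + 1) = 0 by rewrite F0// gtr0_norm ?addr_gt0// ltrDl.
have FNB : F (- (B + 1)) = 0 by rewrite F0// normrN gtr0_norm ?addr_gt0// ltrDl.
transitivity (\int[lebesgue_measure]_(t in `[(- (B + 1))%R, (B + 1)%R]) (f t)%:E)%E;
  last rewrite (@continuous_FTC2 R f F _ _ BB) ?FB ?FNB ?sube0//.
- rewrite [RHS]integral_mkcond; apply: eq_integral => t _; rewrite patchE.
  case: ifPn => //; rewrite notin_setE /= in_itv/= -ler_norml => /negP.
  by rewrite -ltNge => Bt; rewrite f0// (lt_trans _ Bt)// ltrDl.
- exact: continuous_subspaceT.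
- split; first by move=> t _; exact: dF.
  + exact: cvg_at_right_filter (cF _).
  + exact: cvg_at_left_filter (cF _).
Qed.

(* Fubini reduces the claim to the fundamental theorem of calculus along the
   differentiated coordinate, the function vanishing at both ends. *)
Lemma integral_partial n (j : 'I_n) (f : 'rV[R]_n -> R) (B : R) : 0 < B ->
  (forall x, derivable f x (delta_mx ord0 j)) -> continuous (partial j f) ->
  (forall x, ~ box B x -> f x = 0) ->
  (\int[lebesgue_rV n]_x (partial j f x)%:E = 0)%E.
Proof.
move=> B0; elim: n => [|n ih] in j f *; first by case: j.
move=> df cdf f0.
have intf : (lebesgue_rV n.+1).-integrable setT (EFin \o partial j f).
  apply: (continuous_box_integrable (B := B)) => // x.
  exact: partial_eq0 (@closed_box _ B) f0.
rewrite integral_rV_cons//.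
have intf' := integrable_rV_cons intf.
(* If [j] is a later coordinate, the first one is frozen and the induction hypothesis handles the
   inner integral; if [j] is the first coordinate, the inner integral is one-dimensional. *)
have [k jk|j0] := unliftP ord0 j.
  subst j; rewrite -(integral12_prod_meas1 intf') /fubini_F/=.
  apply: integral0_eq => t _.
  have pE y : partial (lift ord0 k) f (rV_cons (t, y)) =
      partial k (fun y => f (rV_cons (t, y))) y.
    by apply: (derive_line_eq _).1 => h; rewrite rV_cons_tail.
  under eq_integral do rewrite pE.
  apply: ih.
  - move=> y; have := df (rV_cons (t, y)); apply: (derive_line_eq _).2 => h.
    by rewrite rV_cons_tail.
  - rewrite (_ : partial _ _ = partial (lift ord0 k) f \o (fun y => rV_cons (t, y))).
      move=> y; apply: continuous_comp; first exact: continuous_rV_cons_tail.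
      exact: cdf.
    by apply/funext => y /=; rewrite pE.
  - move=> y By; apply: f0 => Bty; apply: By => i.
    by have := Bty (lift ord0 i); rewrite rV_consS.
subst j; rewrite -(integral21_prod_meas1 intf') /fubini_G/=.
apply: integral0_eq => y _.
have pE t : partial ord0 f (rV_cons (t, y)) = derive1 (fun t : R => f (rV_cons (t, y))) t.
  rewrite derive1E; apply: (derive_line_eq _).1 => h.
  by rewrite rV_cons_head [_%:A]mulr1.
apply: (@integral_derive_box (fun t : R => f (rV_cons (t, y))) _ B) => //.
- move=> t; have := df (rV_cons (t, y)); apply: (derive_line_eq _).2 => h.
  by rewrite rV_cons_head [_%:A]mulr1.
- move=> t; apply: (@continuous_comp _ _ _ (fun t : R => rV_cons (t, y)) (partial ord0 f)).
    exact: continuous_rV_cons_head.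
  exact: cdf.
- move=> t Bt; apply: f0 => /(_ ord0); rewrite rV_cons0/=.
  by rewrite leNgt Bt.
Qed.

End weak_derivative.

(** * The Frobenius inner product *)

Section frobenius.
Context {R : realType} {p q : nat}.
Implicit Types A B : 'M[R]_(p, q).

Definition frob_dot A B : R := \sum_i \sum_j A i j * B i j.

Lemma sqr_frob_norm A : frob_norm A ^+ 2 = frob_dot A A.
Proof.
rewrite /frob_norm sqr_sqrtr; last first.
  by apply: sumr_ge0 => i _; apply: sumr_ge0 => j _; exact: sqr_ge0.
by apply: eq_bigr => i _; apply: eq_bigr => j _; rewrite expr2.
Qed.

Lemma frob_dotC A B : frob_dot A B = frob_dot B A.
Proof. by apply: eq_bigr => i _; apply: eq_bigr => j _; rewrite mulrC. Qed.

Lemma frob_dotDl (a b : R) A B C :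
  frob_dot (a *: A + b *: B) C = a * frob_dot A C + b * frob_dot B C.
Proof.
rewrite /frob_dot !mulr_sumr -big_split/=; apply: eq_bigr => i _.
rewrite !mulr_sumr -big_split/=; apply: eq_bigr => j _.
by rewrite !mxE mulrDl !mulrA.
Qed.

Lemma frob_dot_ge0 A : 0 <= frob_dot A A.
Proof. by rewrite -sqr_frob_norm sqr_ge0. Qed.

Lemma frob_dot_eq0 A : frob_dot A A = 0 -> A = 0.
Proof.
move=> A0; apply/matrixP => i j; rewrite mxE; apply/eqP; rewrite -sqrf_eq0.
have Ai : \sum_j A i j * A i j = 0.
  move: A0 => /psumr_eq0P; apply => // k _.
  by apply: sumr_ge0 => l _; rewrite -expr2 sqr_ge0.
by rewrite expr2; apply/eqP; move: Ai => /psumr_eq0P; apply => // k _; rewrite -expr2 sqr_ge0.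
Qed.

End frobenius.

Lemma frob_dot_row_mx (R : realType) p q r (A C : 'M[R]_(p, q)) (B D : 'M[R]_(p, r)) :
  frob_dot (row_mx A B) (row_mx C D) = frob_dot A C + frob_dot B D.
Proof.
rewrite /frob_dot -big_split/=; apply: eq_bigr => i _; rewrite big_split_ord/=.
by congr (_ + _); apply: eq_bigr => j _; rewrite ?row_mxEl ?row_mxEr.
Qed.

Lemma frob_dot_tr (R : realType) p q (A B : 'M[R]_(p, q)) :
  frob_dot A^T B^T = frob_dot A B.
Proof.
rewrite /frob_dot exchange_big/=.
by apply: eq_bigr => i _; apply: eq_bigr => j _; rewrite !mxE.
Qed.

Lemma frob_dot_rows (R : realType) p q (A B : 'M[R]_(p, q)) :
  frob_dot A B = \sum_i frob_dot (row i A) (row i B).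
Proof.
apply: eq_bigr => i _; rewrite /frob_dot big_ord1.
by apply: eq_bigr => j _; rewrite !mxE.
Qed.

(** The squared norms of the symmetric and skew parts are half of the squared norm of [A] plus,
    respectively minus, half of its product with [A^T]; they add up to that of [A], and the skew one
    is nonnegative. *)
Lemma frob_dot_symM (R : realType) n (A : 'M[R]_n) :
  frob_dot (symM A) (symM A) <= frob_dot A A.
Proof.
have := frob_dot_ge0 (skewM A).
have dotD (a b : R) : frob_dot (a *: A + b *: A^T) (a *: A + b *: A^T) =
    (a ^+ 2 + b ^+ 2) * frob_dot A A + a * b * 2 * frob_dot A A^T.
  rewrite frob_dotDl 2!(frob_dotC _ (_ + _)) !frob_dotDl frob_dot_tr.
  by rewrite (frob_dotC A^T A); ring.
rewrite /symM /skewM scalerBr scalerDr -scaleNr !dotD.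
by lra.
Qed.

(** * Square integrable functions and matrix fields *)

Section L2_theory.
Context d (T : measurableType d) (R : realType).
Variables (mu : {measure set T -> \bar R}) (D : set T).
Hypothesis mD : measurable D.
Local Notation L2 := (L2 mu D).

Lemma L2_sqr_integrable f : L2 f -> mu.-integrable D (EFin \o (fun x => f x ^+ 2)).
Proof.
move=> [mf foo]; apply/integrableP; split.
  by apply/measurable_EFinP; exact: measurable_funX.
rewrite (_ : (fun x => `|_|%E) = (fun x => (f x ^+ 2)%:E))//.
by apply/funext => x /=; rewrite ger0_norm// sqr_ge0.
Qed.

(** Domination by [f ^+ 2 + g ^+ 2]. *)
Lemma L2_mul_integrable f g : L2 f -> L2 g ->
  mu.-integrable D (EFin \o (fun x => f x * g x)).
Proof.
move=> Lf Lg.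
apply: (@le_integrable _ _ _ _ _ mD _ (fun x => (f x ^+ 2)%:E + (g x ^+ 2)%:E)%E).
- by apply/measurable_EFinP; apply: measurable_funM; [case: Lf|case: Lg].
- move=> x Dx /=; rewrite lee_fin [leRHS]ger0_norm ?addr_ge0 ?sqr_ge0//.
  by rewrite ler_norml; nra.
- by apply: integrableD => //; exact: L2_sqr_integrable.
Qed.

Lemma L2_lin (a b : R) f g : L2 f -> L2 g -> L2 (fun x => a * f x + b * g x).
Proof.
move=> Lf Lg; have mf : measurable_fun D (fun x => a * f x + b * g x).
  by apply: measurable_funD; apply: measurable_funM; [|case: Lf| |case: Lg].
split => //.
suff /integrableP[_] : mu.-integrable D (EFin \o (fun x => (a * f x + b * g x) ^+ 2)).
  by under eq_integral do rewrite gee0_abs ?lee_fin ?sqr_ge0//.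
apply: (@le_integrable _ _ _ _ _ mD _
  (fun x => (2 * a ^+ 2)%:E * (f x ^+ 2)%:E + (2 * b ^+ 2)%:E * (g x ^+ 2)%:E)%E).
- by apply/measurable_EFinP; exact: measurable_funX.
- move=> x Dx /=; rewrite lee_fin ger0_norm ?sqr_ge0//.
  rewrite (le_trans _ (ler_norm _))//.
  (* This square is exactly the gap between the dominating function and
     [(a * f x + b * g x) ^+ 2]. *)
  have := sqr_ge0 (a * f x - b * g x).
  by rewrite sqrrB sqrrD !exprMn; lra.
- by apply: integrableD => //; apply: integrableZl => //; exact: L2_sqr_integrable.
Qed.

Lemma L2_0 : L2 (fun=> 0).
Proof.
split; first exact: measurable_cst.
by under eq_integral do rewrite expr0n/=; rewrite integral0 ltry.
Qed.

(** Integrability and additivity are proved together, since splitting off one term of the integral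
    requires the remaining sum to be integrable. *)
Lemma Rintegral_sum (I : Type) (s : seq I) (f : I -> T -> R) :
  (forall i, mu.-integrable D (EFin \o f i)) ->
  mu.-integrable D (EFin \o (fun x => \sum_(i <- s) f i x)) /\
  \int[mu]_(x in D) (\sum_(i <- s) f i x) = \sum_(i <- s) \int[mu]_(x in D) f i x.
Proof.
move=> intf; elim: s => [|i s [IH1 IH2]].
  split; last first.
    by rewrite big_nil; under eq_Rintegral do rewrite big_nil; rewrite Rintegral_cst// mul0r.
  rewrite (_ : _ \o _ = cst 0%E); first exact: integrable0.
  by apply/funext => x /=; rewrite big_nil.
have E : (fun x => \sum_(k <- i :: s) f k x) = (fun x => f i x + \sum_(k <- s) f k x).
  by apply/funext => x; rewrite big_cons.
rewrite E; split; last by rewrite RintegralD// IH2 big_cons.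
have := integrableD mD (intf i) IH1; congr (_.-integrable _ _).
Qed.

Section matrix_valued.
Context {p q : nat}.
Implicit Types f g h : T -> 'M[R]_(p, q).

Definition L2M f := forall i j, L2 (fun x => f x i j).

Definition L2M_inner f g : R := \int[mu]_(x in D) frob_dot (f x) (g x).

Lemma L2M_dot_integrable f g : L2M f -> L2M g ->
  mu.-integrable D (EFin \o (fun x => frob_dot (f x) (g x))).
Proof.
move=> Lf Lg; apply: (Rintegral_sum _ _).1 => i.
by apply: (Rintegral_sum _ _).1 => j; exact: L2_mul_integrable.
Qed.

Lemma L2M_lin (a b : R) f g : L2M f -> L2M g -> L2M (fun x => a *: f x + b *: g x).
Proof.
move=> Lf Lg i j; rewrite (_ : (fun _ => _) = (fun x => a * f x i j + b * g x i j)).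
  exact: L2_lin.
by apply/funext => x; rewrite !mxE.
Qed.

Lemma L2MB f g : L2M f -> L2M g -> L2M (fun x => f x - g x).
Proof.
move=> Lf Lg; rewrite (_ : (fun _ => _) = (fun x => 1 *: f x + (-1) *: g x)).
  exact: L2M_lin.
by apply/funext => x; rewrite scale1r scaleN1r.
Qed.

Lemma L2M_0 : L2M (fun=> 0).
Proof. by move=> i j; under eq_fun do rewrite mxE; exact: L2_0. Qed.

Lemma L2M_innerC f g : L2M_inner f g = L2M_inner g f.
Proof. by apply: eq_Rintegral => x _; rewrite frob_dotC. Qed.

Lemma L2M_innerDl (a b : R) f g h : L2M f -> L2M g -> L2M h ->
  L2M_inner (fun x => a *: f x + b *: g x) h = a * L2M_inner f h + b * L2M_inner g h.
Proof.
move=> Lf Lg Lh; rewrite /L2M_inner.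
have intfh := L2M_dot_integrable Lf Lh; have intgh := L2M_dot_integrable Lg Lh.
under eq_Rintegral do rewrite frob_dotDl.
rewrite RintegralD//; first by rewrite !RintegralZl.
- by have := integrableZl mD a intfh; congr (_.-integrable _ _).
- by have := integrableZl mD b intgh; congr (_.-integrable _ _).
Qed.

Lemma L2M_inner_ge0 f : 0 <= L2M_inner f f.
Proof. by apply: Rintegral_ge0 => x _; exact: frob_dot_ge0. Qed.

Lemma L2M_normE f : L2M_norm mu D f = Num.sqrt (L2M_inner f f).
Proof.
by congr Num.sqrt; apply: eq_Rintegral => x _; rewrite sqr_frob_norm.
Qed.

Lemma sqr_L2M_norm f : L2M_norm mu D f ^+ 2 = L2M_inner f f.
Proof. by rewrite L2M_normE sqr_sqrtr// L2M_inner_ge0. Qed.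

Lemma L2M_norm_ge0 f : 0 <= L2M_norm mu D f.
Proof. exact: sqrtr_ge0. Qed.

Lemma L2M_inner_lin (a b : R) f g : L2M f -> L2M g ->
  L2M_inner (fun x => a *: f x + b *: g x) (fun x => a *: f x + b *: g x) =
  a ^+ 2 * L2M_inner f f + 2 * a * b * L2M_inner f g + b ^+ 2 * L2M_inner g g.
Proof.
move=> Lf Lg; have Lfg := L2M_lin a b Lf Lg.
rewrite L2M_innerDl// !(L2M_innerC _ (fun x => _ + _)) !L2M_innerDl//.
by rewrite (L2M_innerC g f); ring.
Qed.

Lemma L2M_normZ (a : R) f : L2M f ->
  L2M_norm mu D (fun x => a *: f x) = `|a| * L2M_norm mu D f.
Proof.
move=> Lf; rewrite !L2M_normE (_ : (fun _ => _) = (fun x => a *: f x + 0 *: f x)).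
  by rewrite L2M_inner_lin// mulr0 expr0n/= !mul0r !addr0 sqrtrM ?sqr_ge0// sqrtr_sqr.
by apply/funext => x; rewrite scale0r addr0.
Qed.

Lemma L2M_Cauchy_Schwarz f g : L2M f -> L2M g ->
  L2M_inner f g ^+ 2 <= L2M_inner f f * L2M_inner g g.
Proof.
move=> Lf Lg; have H s t := L2M_inner_ge0 (fun x => s *: f x + t *: g x).
have := L2M_inner_ge0 g; rewrite le_eqVlt => /predU1P[g0|g0].
  (* As [g] has norm 0, the squared norm of this combination is [- L2M_inner f g ^+ 2], which forces
     the inner product to vanish. *)
  have := H (- L2M_inner f g) ((L2M_inner f f + 1) / 2).
  by rewrite L2M_inner_lin// -g0; nra.
have := H (L2M_inner g g) (- L2M_inner f g); rewrite L2M_inner_lin//.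
rewrite (_ : _ + _ = L2M_inner g g *
  (L2M_inner f f * L2M_inner g g - L2M_inner f g ^+ 2)); last by ring.
by rewrite pmulr_rge0// subr_ge0.
Qed.

Lemma ler_L2M_normD f g : L2M f -> L2M g ->
  L2M_norm mu D (fun x => f x + g x) <= L2M_norm mu D f + L2M_norm mu D g.
Proof.
move=> Lf Lg; have := L2M_Cauchy_Schwarz Lf Lg; rewrite -!sqr_L2M_norm.
have f0 := L2M_norm_ge0 f; have g0 := L2M_norm_ge0 g => CS.
rewrite -(@ler_pXn2r _ 2)// ?nnegrE ?addr_ge0 ?L2M_norm_ge0//.
rewrite sqr_L2M_norm (_ : (fun _ => _) = (fun x => 1 *: f x + 1 *: g x)); last first.
  by apply/funext => x; rewrite !scale1r.
rewrite L2M_inner_lin// sqrrD -!sqr_L2M_norm expr1n !mul1r !mulr1 lerD2r lerD2l.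
rewrite -[leRHS]mulr_natl ler_pM2l// leNgt; apply/negP => lt.
by have := mulr_ge0 f0 g0; nra.
Qed.

(** Lets scalar inequalities with a common constant pass to vector valued functions, by squaring and
    summing over the rows. *)
Lemma L2M_norm_rows f : L2M f ->
  L2M_norm mu D f ^+ 2 = \sum_i L2M_norm mu D (fun x => row i (f x)) ^+ 2.
Proof.
move=> Lf; rewrite sqr_L2M_norm /L2M_inner.
under eq_Rintegral do rewrite frob_dot_rows.
rewrite (Rintegral_sum _ _).2; last first.
  move=> i; rewrite (_ : _ \o _ = EFin \o (fun x => \sum_j f x i j * f x i j)).
    by apply: (Rintegral_sum _ _).1 => j; exact: L2_mul_integrable.
  apply/funext => x /=; rewrite /frob_dot big_ord1.
  by congr EFin; apply: eq_bigr => j _; rewrite mxE.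
apply: eq_bigr => i _; rewrite /L2M_norm /L2_norm sqr_sqrtr.
  by apply: eq_Rintegral => x _; rewrite sqr_frob_norm.
by apply: Rintegral_ge0 => x _; exact: sqr_ge0.
Qed.

Lemma L2M_norm_eq0 f : L2M f -> L2M_norm mu D f = 0 ->
  f = (fun=> 0) %[ae mu in D].
Proof.
move=> Lf f0; have intf := L2M_dot_integrable Lf Lf.
have : (\int[mu]_(x in D) `|(frob_dot (f x) (f x))%:E| = 0)%E.
  rewrite (eq_integral (EFin \o (fun x => frob_dot (f x) (f x)))); last first.
    by move=> x _; rewrite gee0_abs// lee_fin frob_dot_ge0.
  rewrite -[LHS]fineK; last exact: integrable_fin_num.
  by congr EFin; have := sqr_L2M_norm f; rewrite f0 expr0n => /esym.
have mf : measurable_fun D (EFin \o (fun x => frob_dot (f x) (f x))).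
  by case/integrableP : intf.
move=> /(ae_eq_integral_abs mu mD mf).
by apply: filterS => x /= + Dx => /(_ Dx) -[]; exact: frob_dot_eq0.
Qed.

Lemma L2M_norm_ae f g : L2M f -> L2M g -> f = g %[ae mu in D] ->
  L2M_norm mu D f = L2M_norm mu D g.
Proof.
move=> Lf Lg fg; rewrite !L2M_normE; congr (Num.sqrt (fine _)).
apply: ae_eq_integral => //.
- by case/integrableP : (L2M_dot_integrable Lf Lf).
- by case/integrableP : (L2M_dot_integrable Lg Lg).
- by apply: filterS fg => x /= + Dx => /(_ Dx) ->.
Qed.

Lemma L2M_inner_ael f g h : L2M f -> L2M g -> L2M h -> f = g %[ae mu in D] ->
  L2M_inner f h = L2M_inner g h.
Proof.
move=> Lf Lg Lh fg; congr (fine _).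
apply: ae_eq_integral => //.
- by case/integrableP : (L2M_dot_integrable Lf Lh).
- by case/integrableP : (L2M_dot_integrable Lg Lh).
- by apply: filterS fg => x /= + Dx => /(_ Dx) ->.
Qed.

End matrix_valued.
End L2_theory.

(** * A seminorm controlled by a semidefinite form in finite dimension *)

Section finite_dimensional_bound.
Context {R : realType} {V : vectType R}.
Variables (a : V -> V -> R) (N : V -> R).
Hypothesis aC : forall u v, a u v = a v u.
Hypothesis aDl : forall t u v w, a (t *: u + v) w = t * a u w + a v w.
Hypothesis a_ge0 : forall u, 0 <= a u u.
Hypothesis ND : forall t u v, N (t *: u + v) <= `|t| * N u + N v.
Hypothesis aN : forall u, a u u = 0 -> N u = 0.

Let a0l w : a 0 w = 0.
Proof. by have := aDl (-1) 0 0 w; rewrite scaler0 addr0 mulN1r addNr. Qed.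

Let aDr t u v w : a w (t *: u + v) = t * a w u + a w v.
Proof. by rewrite aC aDl !(aC _ w). Qed.

Let aZl t u w : a (t *: u) w = t * a u w.
Proof. by rewrite -[_ *: _]addr0 aDl a0l addr0. Qed.

(** On the chosen combination of [u] and [f] the quadratic form equals [- a u f ^+ 2], which
    positivity allows only if [a u f = 0]. *)
Let a_isotropic u f : a f f = 0 -> a u f = 0.
Proof.
move=> f0; have := a_ge0 ((- a u f) *: u + ((a u u + 1) / 2) *: f).
rewrite aDl aZl !aDr !(aC _ (_ *: f)) !aZl (aC f u) f0 => h.
by apply/eqP; rewrite -sqrf_eq0 eq_le sqr_ge0 andbT; nra.
Qed.

(* Gram-Schmidt: the orthogonal projections onto the span of [s] are carried
   along with the bound, as the next vector is replaced by its residual. *)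
Let span_bound (s : seq V) :
  (exists2 c, 0 <= c & forall v, v \in << s >>%VS -> N v <= c * Num.sqrt (a v v)) /\
  (forall e, exists2 p, p \in << s >>%VS & forall v, v \in << s >>%VS -> a (e - p) v = 0).
Proof.
elim: s => [|e s [[c c0 hc] hp]].
  rewrite span_nil; split.
    by exists 0 => // v; rewrite memv0 => /eqP ->; rewrite mul0r aN// a0l.
  move=> e; exists 0; first exact: mem0v.
  by move=> v; rewrite memv0 => /eqP ->; rewrite aC a0l.
have [p ps ep] := hp e; pose f := e - p.
have decomp v : v \in <<e :: s>>%VS -> exists k w, w \in << s >>%VS /\ v = k *: f + w.
  rewrite span_cons => /memv_addP[_ /vlineP[k ->] [w ws ->]].
  exists k, (k *: p + w); split; first by rewrite memvD// memvZ.
  by rewrite addrA -scalerDr subrK.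
have fs : f \in <<e :: s>>%VS.
  by rewrite span_cons memv_add ?memv_line// memvN.
have ss w : w \in << s >>%VS -> w \in <<e :: s>>%VS.
  by move=> ws; rewrite span_cons -[w]add0r memv_add// mem0v.
have af w : w \in << s >>%VS -> a w f = 0 by move=> ws; rewrite aC ep.
split.
  (* If [a f f = 0] the quotient is 0 by convention, which suffices because [N f] is then 0 as
     well. *)
  pose cf := `|N f| / Num.sqrt (a f f).
  have cf0 : 0 <= cf by rewrite divr_ge0// sqrtr_ge0.
  have Nf : N f <= cf * Num.sqrt (a f f).
    have [f0|f0] := eqVneq (a f f) 0; first by rewrite aN// mulr_ge0// sqrtr_ge0.
    by rewrite divfK ?ler_norm// sqrtr_eq0 -ltNge lt_def f0 a_ge0.
  exists (cf + c); first exact: addr_ge0.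
  move=> _ /decomp[k [w [ws ->]]]; apply: le_trans (ND _ _ _) _.
  (* Pythagoras: [f] is orthogonal to the span of [s], so each of the two components is at most the
     whole vector in norm. *)
  have -> : a (k *: f + w) (k *: f + w) = k ^+ 2 * a f f + a w w.
    by rewrite aDl !aDr (aC f w) (af w)// mulr0 addr0 add0r mulrA expr2.
  rewrite mulrDl lerD//.
    apply: (@le_trans _ _ (cf * Num.sqrt (k ^+ 2 * a f f))).
      by rewrite sqrtrM ?sqr_ge0// sqrtr_sqr mulrCA ler_wpM2l.
    by rewrite ler_wpM2l// ler_wsqrtr// lerDl.
  apply: le_trans (hc _ ws) _; rewrite ler_wpM2l// ler_wsqrtr// lerDr.
  by rewrite mulr_ge0// sqr_ge0.
(* The new projection adds the component along the residual [f]. If [a f f = 0], then [t] is 0 by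
   convention and [a e' f] vanishes by [a_isotropic]. *)
move=> e'; have [p' ps' ep'] := hp e'; pose t := a e' f / a f f.
exists (t *: f + p'); first by rewrite memvD// ?memvZ// ss.
move=> _ /decomp[k [w [ws ->]]].
have -> : e' - (t *: f + p') = (- t) *: f + (e' - p').
  by rewrite opprD scaleNr addrCA.
rewrite aDl !aDr (ep' w)// (aC f w) (af w)// !addr0.
have -> : a (e' - p') f = a e' f.
  by rewrite -[e' - p']addrC -scaleN1r aDl af// mulr0 add0r.
rewrite /t; have [f0|f0] := eqVneq (a f f) 0.
  by rewrite f0 !mulr0 add0r a_isotropic// mulr0.
by rewrite mulNr mulrCA divfK// addNr.
Qed.

(** The bound on spans is applied to a basis of the whole space. It is meant for the inner product
    of traces as [a] and the [W^{1,2}] norm as [N], both pulled back to a space parametrizing rigid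
    displacements. *)
Lemma seminorm_bound :
  exists2 c, 0 <= c & forall v, N v <= c * Num.sqrt (a v v).
Proof.
have [[c c0 hc] _] := span_bound (vbasis {:V}); exists c => // v; apply: hc.
by rewrite (span_basis (vbasisP _)) memvf.
Qed.

End finite_dimensional_bound.

(** * Affine functions *)

Section affine.
Context {R : realType} {n : nat}.
Implicit Types (c : R) (m x : 'rV[R]_n).

(** The shape of the components of a rigid displacement. *)
Definition affine c m x : R := c + \sum_k x ord0 k * m ord0 k.

Lemma continuous_affine c m : continuous (affine c m).
Proof.
move=> x.
apply: (@continuousD _ _ _ (fun=> c) (fun x => \sum_k x ord0 k * m ord0 k)).
  exact: cst_continuous.
apply: continuous_big => [|k _ y]; first exact: add_continuous.
apply: (@continuousM _ _ (fun y : 'rV[R]_n => y ord0 k) (fun=> m ord0 k)).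
  exact: coord_continuous.
exact: cst_continuous.
Qed.

(** Along a coordinate direction the difference quotient is constant for nonzero increments. *)
Lemma is_derive_affine c m (j : 'I_n) x :
  is_derive x (delta_mx ord0 j) (affine c m) (m ord0 j).
Proof.
have E (h : R) : affine c m (h *: delta_mx ord0 j + x) - affine c m x = h * m ord0 j.
  rewrite /affine opprD addrACA subrr add0r -sumrB (bigD1 j)//= big1 ?addr0.
    by rewrite !mxE !eqxx mulr1 mulrDl addrK.
  by move=> k kj; rewrite !mxE eqxx (negbTE kj) mulr0 add0r subrr.
have : (fun h : R => h^-1 *: ((affine c m \o shift x) (h *: delta_mx ord0 j)
    - affine c m x)) h @[h --> 0^'] --> m ord0 j.
  apply: cvg_near_cst; near=> h; rewrite /= E [_ *: _]mulrA mulVf ?mul1r//.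
  by near: h; exact: nbhs_dnbhs_neq.
move=> cv; split; first by apply/cvg_ex; exists (m ord0 j).
exact: cvg_lim cv.
Unshelve. all: by end_near. Qed.

Lemma affine_box_bounded c m (B : R) x : box B x ->
  `|affine c m x| <= `|c| + \sum_k B * `|m ord0 k|.
Proof.
move=> Bx; apply: le_trans (ler_normD _ _) _; rewrite lerD2l.
apply: le_trans (ler_norm_sum _ _ _) _; apply: ler_sum => k _.
by rewrite normrM ler_wpM2r//; exact: Bx.
Qed.

End affine.

(** * The space [W^{1,2}] on a bounded open set *)

Section W12_theory.
Context {R : realType} {n : nat}.
Variable Omega : set 'rV[R]_n.
Hypotheses (oOmega : open Omega) (bOmega : bounded_set Omega).
Local Notation lambda := (lebesgue_rV n).

Let mOmega : measurable Omega. Proof. exact: measurable_open_rV. Qed.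

Let Omega_fin : (lambda Omega < +oo)%E.
Proof. exact: lebesgue_rV_bounded. Qed.

Lemma bounded_L2 (f : 'rV[R]_n -> R) (M : R) : measurable_fun setT f ->
  (forall x, Omega x -> `|f x| <= M) -> L2 lambda Omega f.
Proof.
move=> mf fM; have mOf : measurable_fun Omega f by exact: measurable_funTS.
split => //; have /integrableP[_] : lambda.-integrable Omega (EFin \o (fun x => f x ^+ 2)).
  apply: (bounded_integrable (M := M ^+ 2)) => //; first exact: measurable_funX.
  by move=> x Ox; rewrite normrX lerXn2r ?nnegrE// ?fM// (le_trans _ (fM x Ox)).
apply: le_lt_trans; rewrite le_eqVlt; apply/orP; left; apply/eqP.
by apply: eq_integral => x _; rewrite gee0_abs// lee_fin sqr_ge0.
Qed.

Lemma cst_L2 (c : R) : L2 lambda Omega (fun=> c).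
Proof. exact: (bounded_L2 (M := `|c|) (@measurable_cst _ _ _ _ setT c)). Qed.

Lemma affine_L2 c m : L2 lambda Omega (affine c m).
Proof.
have [B _ OB] := bounded_set_box bOmega.
apply: (bounded_L2 (M := `|c| + \sum_k B * `|m ord0 k|)).
  by apply: continuous_measurable_rV; exact: continuous_affine.
by move=> x /OB; exact: affine_box_bounded.
Qed.

Lemma test_function_box phi : test_function Omega phi ->
  exists (K : set 'rV[R]_n) (B : R), [/\ 0 < B, closed K, K `<=` Omega, K `<=` box B &
    forall x, ~ K x -> phi x = 0].
Proof.
move=> [_ [K [cK KO phi0]]].
have [B B0 KB] := bounded_set_box (compact_bounded cK).
exists K, B; split => //.
by apply: compact_closed => //; exact: norm_hausdorff.
Qed.

Lemma test_function_L2 phi : test_function Omega phi -> L2 lambda Omega phi.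
Proof.
move=> tphi; have [K [B [B0 cK KO KB phi0]]] := test_function_box tphi.
have cphi : continuous phi by have := tphi.1 0.
have [|M M0 hM] := continuous_box_bounded (B := B) cphi.
  by move=> x Bx; apply: phi0 => /KB.
by apply: (bounded_L2 (M := M)) => //; exact: continuous_measurable_rV.
Qed.

Lemma partial_test_function_L2 phi j : test_function Omega phi ->
  L2 lambda Omega (partial j phi).
Proof.
move=> tphi; have [K [B [B0 cK KO KB phi0]]] := test_function_box tphi.
have cphi : continuous (partial j phi) by have [_] := tphi.1 1; exact.
have [|M M0 hM] := continuous_box_bounded (B := B) cphi.
  by move=> x Bx; apply: (partial_eq0 j cK phi0) => /KB.
by apply: (bounded_L2 (M := M)) => //; exact: continuous_measurable_rV.
Qed.

(** The product [psi] of the affine function and the test function vanishes outside a cube, so its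
    partial derivative has integral 0; the product rule turns this into the integration by parts
    formula. *)
Lemma W12_affine c m : W12 Omega (affine c m) (fun=> m).
Proof.
split; [exact: affine_L2|by move=> i; exact: cst_L2|].
move=> j phi tphi; have [K [B [B0 cK KO KB phi0]]] := test_function_box tphi.
have cphi : continuous phi by have := tphi.1 0.
have [dphi cdphi] : (forall x, derivable phi x (delta_mx ord0 j)) /\
    continuous (partial j phi).
  by have [h1 h2] := tphi.1 1; split => //; exact: h2.
pose psi := affine c m * phi.
have daff x : derivable (affine c m) x (delta_mx ord0 j).
  exact: (@ex_derive _ _ _ _ _ _ _ (is_derive_affine c m j x)).
have vaff x : 'D_(delta_mx ord0 j) (affine c m) x = m ord0 j.
  exact: (@derive_val _ _ _ _ _ _ _ (is_derive_affine c m j x)).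
have dpsi x : derivable psi x (delta_mx ord0 j).
  exact: derivableM.
have pE x : partial j psi x = affine c m x * partial j phi x + m ord0 j * phi x.
  by rewrite /partial deriveM// vaff [phi x *: _]mulrC.
have psi0 x : ~ K x -> psi x = 0.
  by move=> /phi0 h; rewrite /psi /= [LHS]/GRing.mul/= h mulr0.
have cp : continuous (partial j psi).
  rewrite (_ : partial j psi =
    (fun x => affine c m x * partial j phi x + m ord0 j * phi x)).
    move=> x; apply: (@continuousD _ _ _ (fun x => affine c m x * partial j phi x)
      (fun x => m ord0 j * phi x)).
      apply: (@continuousM _ _ (affine c m) (partial j phi)); last exact: cdphi.
      exact: continuous_affine.
    apply: (@continuousM _ _ (fun=> m ord0 j) phi); last exact: cphi.
    exact: cst_continuous.
  by apply/funext => x; exact: pE.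
(* The integral over [Omega] is the one over the whole space, since the derivative vanishes outside
   [K], which lies in [Omega]. *)
have Z : \int[lambda]_(x in Omega) partial j psi x = 0.
  rewrite Rintegral_mkcond /Rintegral (_ : (fun x => _) = EFin \o partial j psi).
    rewrite (@integral_partial R n j psi B B0 dpsi cp)// => x Bx.
    by apply: psi0 => /KB.
  apply/funext => x /=; rewrite patchE; case: ifPn => //.
  rewrite notin_setE => Ox; rewrite (partial_eq0 j cK psi0)// => /KO.
  exact: Ox.
apply/eqP; rewrite -addr_eq0 -[X in _ == X]Z.
rewrite -RintegralD//.
- by apply/eqP; apply: eq_Rintegral => x _; rewrite pE.
- apply: L2_mul_integrable => //; first exact: affine_L2.
  exact: partial_test_function_L2.
- exact: (L2_mul_integrable mOmega (cst_L2 (m ord0 j)) (test_function_L2 tphi)).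
Qed.

Lemma W12_lin a b u v Gu Gv : W12 Omega u Gu -> W12 Omega v Gv ->
  W12 Omega (fun x => a * u x + b * v x) (fun x => a *: Gu x + b *: Gv x).
Proof.
move=> [Lu LGu wu] [Lv LGv wv]; split; first exact: L2_lin.
  move=> i; rewrite (_ : (fun x => _) = (fun x => a * Gu x ord0 i + b * Gv x ord0 i)).
    exact: L2_lin.
  by apply/funext => x; rewrite !mxE.
move=> j phi tphi.
have Lp := test_function_L2 tphi; have Ldp := partial_test_function_L2 j tphi.
have lin f g h : L2 lambda Omega f -> L2 lambda Omega g -> L2 lambda Omega h ->
    \int[lambda]_(x in Omega) ((a * f x + b * g x) * h x) =
    a * \int[lambda]_(x in Omega) (f x * h x) + b * \int[lambda]_(x in Omega) (g x * h x).
  move=> Lf Lg Lh; have fh := L2_mul_integrable mOmega Lf Lh.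
  have gh := L2_mul_integrable mOmega Lg Lh.
  under eq_Rintegral do rewrite mulrDl -!mulrA.
  rewrite RintegralD//; first by rewrite !RintegralZl.
  - by have := integrableZl mOmega a fh; congr (_.-integrable _ _).
  - by have := integrableZl mOmega b gh; congr (_.-integrable _ _).
rewrite lin// wu// wv//.
under [in RHS]eq_Rintegral do rewrite !mxE.
by rewrite lin// opprD !mulrN.
Qed.

Lemma W12V_lin p a b (u v : 'rV[R]_n -> 'rV[R]_p) Gu Gv :
  W12V Omega u Gu -> W12V Omega v Gv ->
  W12V Omega (fun x => a *: u x + b *: v x) (fun x => a *: Gu x + b *: Gv x).
Proof.
move=> hu hv i; have := W12_lin a b (hu i) (hv i).
congr W12; apply/funext => x; first by rewrite !mxE.
by apply/rowP => j; rewrite !mxE.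
Qed.

Lemma W12VB p (u v : 'rV[R]_n -> 'rV[R]_p) Gu Gv :
  W12V Omega u Gu -> W12V Omega v Gv ->
  W12V Omega (fun x => u x - v x) (fun x => Gu x - Gv x).
Proof.
move=> hu hv; have := W12V_lin 1 (-1) hu hv.
by congr W12V; apply/funext => x; rewrite scale1r scaleN1r.
Qed.

(** Placing [u] as an extra column next to [G] makes the Sobolev norm an [L^2] norm, which then
    supplies the triangle inequality, homogeneity and the decomposition into components. *)
Lemma W12V_normE p (u : 'rV[R]_n -> 'rV[R]_p) G :
  W12V_norm Omega u G = L2M_norm lambda Omega (fun x => row_mx (u x)^T (G x)).
Proof.
congr Num.sqrt; apply: eq_Rintegral => x _.
by rewrite !sqr_frob_norm frob_dot_row_mx frob_dot_tr.
Qed.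

Lemma W12V_L2M p (u : 'rV[R]_n -> 'rV[R]_p) G : W12V Omega u G ->
  L2M lambda Omega (fun x => row_mx (u x)^T (G x)).
Proof.
move=> hu i j; have [Lu LG _] := hu i; have [k jk|k jk] := fintype.splitP j.
  rewrite (_ : (fun _ => _) = (fun x => u x ord0 i))//.
  have -> : j = lshift n k by exact/val_inj.
  by apply/funext => x; rewrite row_mxEl mxE (ord1 k).
rewrite (_ : (fun _ => _) = (fun x => row i (G x) ord0 k))//.
have -> : j = rshift 1 k by exact/val_inj.
by apply/funext => x; rewrite row_mxEr mxE.
Qed.

Lemma W12V_L2M_gradient p (u : 'rV[R]_n -> 'rV[R]_p) G : W12V Omega u G ->
  L2M lambda Omega G.
Proof.
move=> hu i j; have [_ LG _] := hu i.
by have := LG j; under eq_fun do rewrite mxE.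
Qed.

Lemma W12V_norm_sum p (u : 'rV[R]_n -> 'rV[R]_p) G : W12V Omega u G ->
  W12V_norm Omega u G ^+ 2 =
  \sum_i W12_norm Omega (fun x => u x ord0 i) (fun x => row i (G x)) ^+ 2.
Proof.
move=> hu; rewrite W12V_normE (L2M_norm_rows mOmega (W12V_L2M hu)).
apply: eq_bigr => i _; congr (_ ^+ 2); congr Num.sqrt; apply: eq_Rintegral => x _.
rewrite !sqr_frob_norm row_row_mx frob_dot_row_mx; congr (_ + _).
by rewrite /frob_dot !big_ord1 !mxE expr2.
Qed.

Lemma ler_W12V_normD p (u v : 'rV[R]_n -> 'rV[R]_p) Gu Gv :
  W12V Omega u Gu -> W12V Omega v Gv ->
  W12V_norm Omega (fun x => u x + v x) (fun x => Gu x + Gv x) <=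
  W12V_norm Omega u Gu + W12V_norm Omega v Gv.
Proof.
move=> hu hv; have := ler_L2M_normD mOmega (W12V_L2M hu) (W12V_L2M hv).
rewrite -!W12V_normE; apply: le_trans; rewrite le_eqVlt W12V_normE; apply/orP; left.
by apply/eqP; congr L2M_norm; apply/funext => x; rewrite add_row_mx linearD.
Qed.

Lemma W12V_normZ p a (u : 'rV[R]_n -> 'rV[R]_p) G : W12V Omega u G ->
  W12V_norm Omega (fun x => a *: u x) (fun x => a *: G x) =
  `|a| * W12V_norm Omega u G.
Proof.
move=> hu; rewrite !W12V_normE -(L2M_normZ mOmega _ (W12V_L2M hu)).
by congr L2M_norm; apply/funext => x; rewrite scale_row_mx linearZ.
Qed.

(** Separates the zeroth order part, which Poincare's inequality bounds component by component, from
    the gradient part, which Korn's inequality bounds. *)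
Lemma W12V_norm_sum_parts p (u : 'rV[R]_n -> 'rV[R]_p) G : W12V Omega u G ->
  W12V_norm Omega u G ^+ 2 =
  \sum_i L2_norm lambda Omega (fun x => u x ord0 i) ^+ 2 +
  L2M_norm lambda Omega G ^+ 2.
Proof.
move=> hu; have LG := W12V_L2M_gradient hu.
rewrite W12V_norm_sum// (L2M_norm_rows mOmega LG) -big_split/=.
apply: eq_bigr => i _; have [Lu LGi _] := hu i.
rewrite /W12_norm /L2M_norm /L2_norm !sqr_sqrtr; last 3 first.
- by apply: Rintegral_ge0 => x _; exact: sqr_ge0.
- by apply: Rintegral_ge0 => x _; exact: sqr_ge0.
- by apply: Rintegral_ge0 => x _; rewrite addr_ge0// sqr_ge0.
rewrite RintegralD//; first exact: L2_sqr_integrable.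
have : L2M lambda Omega (fun x => row i (G x)) by move=> k j; rewrite (ord1 k).
move=> L; have := L2M_dot_integrable mOmega L L.
congr (_.-integrable _ _); apply/funext => x /=.
by rewrite sqr_frob_norm.
Qed.

End W12_theory.

(** * Rigid displacements and approximation by them *)

Section rigid_theory.
Context {R : realType} {n : nat}.
Local Notation T := 'rV[R]_n.

Lemma rigid_coordE (b : T) (M : 'M[R]_n) i :
  (fun x : T => (b + x *m M^T) ord0 i) = affine (b ord0 i) (row i M).
Proof.
apply/funext => x; rewrite !mxE; congr (_ + _).
by apply: eq_bigr => k _; rewrite !mxE.
Qed.

Lemma gradient_rigid (b : T) (M : 'M[R]_n) :
  gradient (fun x => b + x *m M^T) = fun=> M.
Proof.
apply/funext => x; apply/matrixP => i j; rewrite mxE rigid_coordE.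
rewrite /partial (@derive_val _ _ _ _ _ _ _ (is_derive_affine _ _ j x)).
by rewrite mxE.
Qed.

(** Read off the normal form [b + M x], whose gradient is the constant matrix [M]. *)
Lemma rigid_lin a b (r s : T -> T) : rigid r -> rigid s ->
  rigid (fun x => a *: r x + b *: s x) /\
  gradient (fun x => a *: r x + b *: s x) =
  (fun x => a *: gradient r x + b *: gradient s x).
Proof.
move=> [c [M [MT ->]]] [e [N [NT ->]]].
have E : (fun x : T => a *: (c + x *m M^T) + b *: (e + x *m N^T)) =
    (fun x : T => (a *: c + b *: e) + x *m (a *: M + b *: N)^T).
  apply/funext => x; have -> : (a *: M + b *: N)^T = a *: M^T + b *: N^T.
    by apply/matrixP => i j; rewrite !mxE.
  by rewrite mulmxDr -!scalemxAr !scalerDr addrACA.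
rewrite E !gradient_rigid; split => //.
exists (a *: c + b *: e), (a *: M + b *: N); split => //.
by rewrite linearD/= !linearZ/= MT NT !scalerN opprD.
Qed.

Lemma skewM_skew (A : 'M[R]_n) : (skewM A)^T = - skewM A.
Proof. by rewrite /skewM linearZ/= linearB/= trmxK -scalerN opprB. Qed.

Lemma skewM_id (M : 'M[R]_n) : M^T = - M -> skewM M = M.
Proof.
move=> /matrixP MT; apply/matrixP => i j; have := MT i j.
by rewrite !mxE => ->; lra.
Qed.

Variable Omega : set T.
Hypotheses (oOmega : open Omega) (bOmega : bounded_set Omega).

Lemma W12V_rigid_form (b : T) (M : 'M[R]_n) :
  W12V Omega (fun x => b + x *m M^T) (fun=> M).
Proof. by move=> i; rewrite rigid_coordE; exact: W12_affine. Qed.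

Lemma W12V_rigid (r : T -> T) : rigid r -> W12V Omega r (gradient r).
Proof.
by move=> [b [M [_ ->]]]; rewrite gradient_rigid; exact: W12V_rigid_form.
Qed.

(* Comparison with the rigid displacement whose gradient is the skew part of
   the mean of the gradient and whose mean is that of u. *)
Lemma rigid_approximation (Q K : R) (u : T -> T) (G : T -> 'M[R]_n) : 0 < Q -> 0 < K ->
  (forall u G, W12 Omega u G ->
    L2_norm (lebesgue_rV n) Omega (fun x => u x - mean (lebesgue_rV n) Omega u) <=
    Q * L2M_norm (lebesgue_rV n) Omega G) ->
  L2M_norm (lebesgue_rV n) Omega
      (fun x => G x - skewM (meanM (lebesgue_rV n) Omega G)) <=
    K * L2M_norm (lebesgue_rV n) Omega (fun x => symM (G x)) ->
  W12V Omega u G ->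
  exists2 w, rigid w &
    W12V_norm Omega (fun x => u x - w x) (fun x => G x - gradient w x) <=
    K * Num.sqrt (1 + Q ^+ 2) * L2M_norm (lebesgue_rV n) Omega (fun x => symM (G x)).
Proof.
move=> Q0 K0 poincare korn hu; set S := L2M_norm _ _ (fun x => symM _).
pose M := skewM (meanM (lebesgue_rV n) Omega G).
(* The gradient of [v] is [G - M], which Korn's inequality bounds; subtracting the mean [c] of [v]
   below yields the left-hand side of Poincare's inequality. *)
pose v (x : T) := u x - (0 + x *m M^T).
have hv : W12V Omega v (fun x => G x - M).
  exact: W12VB hu (W12V_rigid_form 0 M).
pose c : T := \row_i mean (lebesgue_rV n) Omega (fun x => v x ord0 i).
exists (fun x => c + x *m M^T); first by exists c, M; split => //; exact: skewM_skew.
rewrite gradient_rigid.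
have hw : W12V Omega (fun x => u x - (c + x *m M^T)) (fun x => G x - M).
  exact: W12VB hu (W12V_rigid_form c M).
have S0 : 0 <= S by exact: L2M_norm_ge0.
have Q1 : 0 <= 1 + Q ^+ 2 by rewrite addr_ge0// sqr_ge0.
rewrite -(@ler_pXn2r _ 2)// ?nnegrE ?mulr_ge0 ?sqrtr_ge0 ?(ltW K0)//.
rewrite W12V_norm_sum_parts//.
rewrite -/M in korn; set H := L2M_norm _ _ _ in korn *.
have H0 : 0 <= H by exact: L2M_norm_ge0.
(* The gradient part is [H] and the zeroth order part is at most [Q * H], whence the factor
   [1 + Q ^+ 2]; Korn's inequality then replaces [H] by [K * S]. *)
apply: (@le_trans _ _ ((1 + Q ^+ 2) * H ^+ 2)); last first.
  have -> : (K * Num.sqrt (1 + Q ^+ 2) * S) ^+ 2 = (1 + Q ^+ 2) * (K * S) ^+ 2.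
    by rewrite 2!exprMn (sqr_sqrtr Q1) exprMn; ring.
  by rewrite ler_wpM2l// lerXn2r// nnegrE mulr_ge0// (ltW K0).
rewrite mulrDl mul1r addrC lerD2l.
have mO := measurable_open_rV oOmega.
rewrite /H (L2M_norm_rows mO (W12V_L2M_gradient hw)) mulr_sumr.
apply: ler_sum => i _; rewrite -exprMn lerXn2r ?nnegrE ?sqrtr_ge0//.
  by rewrite mulr_ge0 ?sqrtr_ge0 ?(ltW Q0).
apply: le_trans (poincare _ _ (hv i)); rewrite le_eqVlt; apply/orP; left; apply/eqP.
congr L2_norm; apply/funext => x; rewrite /v [c]lock !mxE -lock add0r !mxE.
by rewrite opprD addrA addrAC.
Qed.

End rigid_theory.

(** * Traces of rigid displacements and the norm of [E] *)

Section trace_theory.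
Context {R : realType} {n : nat}.
Local Notation T := 'rV[R]_n.+1.
Variables (Omega Gamma : set T) (gamma : (T -> R) -> T -> R).
Hypotheses (oOmega : open Omega) (bOmega : bounded_set Omega).
Hypothesis mGamma : measurable Gamma.
Hypothesis trgamma : is_trace Omega Gamma gamma.
Local Notation sigma := (@hausdorff R n.+1 n).
Local Notation tr := (traceV gamma).

Lemma L2V_L2M (f : T -> T) : L2V sigma Gamma f <-> L2M sigma Gamma f.
Proof. by split => Lf i => [j|]; [rewrite (ord1 i)|]; exact: Lf. Qed.

Lemma L2V_innerE (f g : T -> T) :
  L2V_inner sigma Gamma f g = L2M_inner sigma Gamma f g.
Proof. by apply: eq_Rintegral => x _; rewrite /frob_dot big_ord1. Qed.

Lemma traceV_L2M (u : T -> T) G : W12V Omega u G -> L2M sigma Gamma (tr u).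
Proof.
move=> hu; apply/L2V_L2M => i; have [tL _ _ _] := trgamma.
by have := tL _ _ (hu i); under [X in _ -> L2 _ _ X]eq_fun do rewrite mxE.
Qed.

Lemma traceV_lin a b (u v : T -> T) Gu Gv : W12V Omega u Gu -> W12V Omega v Gv ->
  tr (fun x => a *: u x + b *: v x) = (fun x => a *: tr u x + b *: tr v x)
  %[ae sigma in Gamma].
Proof.
move=> hu hv; have [_ tlin _ _] := trgamma.
(* The exceptional null sets of the finitely many components are merged into one. *)
have : \forall x \ae sigma, forall i, Gamma x ->
    tr (fun x => a *: u x + b *: v x) x ord0 i =
    (a *: tr u x + b *: tr v x) ord0 i.
  apply: filter_forall => i; have := tlin a b _ _ _ _ (hu i) (hv i).
  apply: filterS => x /= + Gx => /(_ Gx); rewrite !mxE => <-.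
  by congr gamma; apply/funext => y; rewrite !mxE.
by apply: filterS => x /= h Gx; apply/rowP => i; exact: h.
Qed.

Lemma sqr_L2M_norm_row (f : T -> T) : L2M sigma Gamma f ->
  L2M_norm sigma Gamma f ^+ 2 =
  \sum_i L2_norm sigma Gamma (fun x => f x ord0 i) ^+ 2.
Proof.
move=> Lf; rewrite sqr_L2M_norm /L2M_inner.
under eq_Rintegral do rewrite /frob_dot big_ord1.
rewrite (Rintegral_sum mGamma _ _).2; last first.
  by move=> i; exact: L2_mul_integrable.
apply: eq_bigr => i _; rewrite /L2_norm sqr_sqrtr//.
by apply: Rintegral_ge0 => x _; exact: sqr_ge0.
Qed.

(** The scalar bound, squared and summed over the components, keeps its constant. *)
Lemma traceV_bound (C : R) (u : T -> T) G : 0 <= C ->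
  (forall u G, W12 Omega u G ->
    L2_norm sigma Gamma (gamma u) <= C * W12_norm Omega u G) ->
  W12V Omega u G -> L2M_norm sigma Gamma (tr u) <= C * W12V_norm Omega u G.
Proof.
move=> C0 tC hu; have Lu := traceV_L2M hu.
rewrite -(@ler_pXn2r _ 2)// ?nnegrE ?mulr_ge0 ?sqrtr_ge0//.
rewrite sqr_L2M_norm_row// exprMn W12V_norm_sum// mulr_sumr.
apply: ler_sum => i _; rewrite -exprMn lerXn2r ?nnegrE ?mulr_ge0 ?sqrtr_ge0//.
apply: le_trans (tC _ _ (hu i)); rewrite le_eqVlt; apply/orP; left; apply/eqP.
by congr L2_norm; apply/funext => x; rewrite mxE.
Qed.

Variable E : (T -> T) -> T -> T.
Hypothesis invE : trace_rigid_inverse Gamma gamma E.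

(** A linear parametrization of the rigid displacements by a full vector space, to which
    [seminorm_bound] applies. Passing through [skewM] makes every matrix admissible; the kernel is
    harmless for a semidefinite form. *)
Let rig (v : T * 'M[R]_n.+1) (x : T) : T := v.1 + x *m (skewM v.2)^T.

Let rigid_rig v : rigid (rig v).
Proof. by exists v.1, (skewM v.2); split => //; exact: skewM_skew. Qed.

Let rig_surj r : rigid r -> exists v, r = rig v.
Proof. by move=> [b [M [MT ->]]]; exists (b, M); rewrite /rig/= skewM_id. Qed.

Let rig_lin t v w : rig (t *: v + w) = fun x => t *: rig v x + 1 *: rig w x.
Proof.
apply/funext => x; rewrite /rig/=.
have -> : (skewM (t *: v.2 + w.2))^T = t *: (skewM v.2)^T + (skewM w.2)^T.
  by apply/matrixP => i j; rewrite !mxE; ring.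
by rewrite mulmxDr -scalemxAr scale1r scalerDr addrACA.
Qed.

Let W_rig v : W12V Omega (rig v) (gradient (rig v)).
Proof. exact/W12V_rigid/rigid_rig. Qed.

Lemma W12V_norm_rigidZ k r : rigid r -> rigid (fun x => k *: r x) /\
  W12V_norm Omega (fun x => k *: r x) (gradient (fun x => k *: r x)) =
  `|k| * W12V_norm Omega r (gradient r).
Proof.
move=> rr; have [] := rigid_lin k 0 rr rr.
have E0 p q (f : T -> 'M[R]_(p, q)) : (fun x => k *: f x + 0 *: f x) = (fun x => k *: f x).
  by apply/funext => x; rewrite scale0r addr0.
rewrite !E0 => rk ->; split => //.
by rewrite W12V_normZ//; exact: W12V_rigid.
Qed.

(** The zero function represents both the trace of [r] and the trace of 0, so [E] maps it to [r] and
    to 0. *)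
Lemma trace_inverse0 r : rigid r -> tr r = (fun=> 0) %[ae sigma in Gamma] ->
  r = fun=> 0.
Proof.
move=> rr r0; have hr := W12V_rigid oOmega bOmega rr.
have L0 : L2V sigma Gamma (fun=> 0 : T) by apply/L2V_L2M; exact: L2M_0.
have <- : E (fun=> 0) = r by apply: invE => //; apply: filterS r0 => x /= h /h.
apply: invE => //.
  by have [] := W12V_norm_rigidZ 0 rr; under eq_fun do rewrite scale0r.
have := traceV_lin 0 0 hr hr.
rewrite (_ : (fun x => 0 *: r x + 0 *: r x) = fun=> 0); last first.
  by apply/funext => x; rewrite !scale0r addr0.
by apply: filterS => x /= h /h ->; rewrite !scale0r addr0.
Qed.

(** [seminorm_bound] along [rig]: a parameter isotropic for the inner product of traces has trace 0
    almost everywhere, so its rigid displacement is 0 by [trace_inverse0]. *)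
Lemma rigid_bound : exists2 c, 0 <= c & forall r, rigid r ->
  W12V_norm Omega r (gradient r) <= c * L2M_norm sigma Gamma (tr r).
Proof.
have Lr v := traceV_L2M (W_rig v).
pose a v w := L2M_inner sigma Gamma (tr (rig v)) (tr (rig w)).
pose N v := W12V_norm Omega (rig v) (gradient (rig v)).
suff [c c0 hc] : exists2 c, 0 <= c & forall v, N v <= c * Num.sqrt (a v v).
  by exists c => // _ /rig_surj[v ->]; rewrite L2M_normE; exact: hc.
apply: (@seminorm_bound R (T * 'M[R]_n.+1)%type a N).
- by move=> u v; exact: L2M_innerC.
- move=> t u v w; rewrite /a (@L2M_inner_ael _ _ _ _ _ mGamma _ _ _
    (fun x => t *: tr (rig u) x + 1 *: tr (rig v) x)) ?L2M_innerDl ?mul1r//.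
    exact: L2M_lin.
  by rewrite rig_lin; exact: traceV_lin.
- by move=> u; exact: L2M_inner_ge0.
- move=> t u v; rewrite /N rig_lin.
  have [_ ->] := rigid_lin t 1 (rigid_rig u) (rigid_rig v).
  rewrite -(W12V_normZ oOmega t (W_rig u)).
  have h1 : W12V Omega (fun x => t *: rig u x) (fun x => t *: gradient (rig u) x).
    have := W12V_lin oOmega bOmega t 0 (W_rig u) (W_rig u).
    by congr W12V; apply/funext => x; rewrite scale0r addr0.
  have E1 p q (f g : T -> 'M[R]_(p, q)) :
      (fun x => t *: f x + 1 *: g x) = (fun x => t *: f x + g x).
    by apply/funext => x; rewrite scale1r.
  by rewrite !E1; exact: ler_W12V_normD.
move=> u au0; have u0 : rig u = fun=> 0.
  apply: trace_inverse0 => //; apply: (L2M_norm_eq0 mGamma (Lr u)).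
  by rewrite L2M_normE -/(a u u) au0 sqrtr0.
have [_] := W12V_norm_rigidZ 0 (rigid_rig u).
by rewrite /N normr0 mul0r u0; under eq_fun do rewrite scaler0.
Qed.

Lemma trace_rigid_inverseE g : trace_rigid Gamma gamma g ->
  [/\ rigid (E g), L2M sigma Gamma g & g = tr (E g) %[ae sigma in Gamma]].
Proof.
by move=> [Lg [r rr gr]]; rewrite (invE rr Lg gr); split => //; exact/L2V_L2M.
Qed.

(** Ensures that [sup] in [op_norm] is a genuine upper bound. As [g] is almost everywhere the trace
    of [E g], the constant of [rigid_bound] serves. *)
Lemma op_norm_has_ubound : has_ubound
  [set W12V_norm Omega (E g) (gradient (E g)) |
    g in [set g | trace_rigid Gamma gamma g /\ L2M_norm sigma Gamma g <= 1]].
Proof.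
have [c c0 hc] := rigid_bound; exists c => _ [g [tg g1] <-].
have [rE Lg gE] := trace_rigid_inverseE tg.
apply: le_trans (hc _ rE) _.
rewrite -(L2M_norm_ae mGamma Lg _ gE); last exact/traceV_L2M/W12V_rigid.
by rewrite ler_piMr.
Qed.

(** Rescaled to unit norm, [h] competes in the supremum, and [E] maps it to the rescaled [r]. *)
Lemma ler_op_norm r h : rigid r -> L2M sigma Gamma h ->
  h = tr r %[ae sigma in Gamma] ->
  W12V_norm Omega r (gradient r) <= op_norm Omega Gamma gamma E * L2M_norm sigma Gamma h.
Proof.
move=> rr Lh hr; have Lr : L2M sigma Gamma (tr r) by exact/traceV_L2M/W12V_rigid.
(* Here [h] cannot be normalised; [rigid_bound] directly bounds the norm of [r] by 0. *)
have [h0|h0] := eqVneq (L2M_norm sigma Gamma h) 0.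
  have [c _ /(_ _ rr)] := rigid_bound.
  by rewrite -(L2M_norm_ae mGamma Lh Lr hr) h0 !mulr0.
have hp : 0 < L2M_norm sigma Gamma h by rewrite lt_def h0 L2M_norm_ge0.
rewrite -ler_pdivrMr// mulrC; set k := _^-1.
have k0 : 0 < k by rewrite invr_gt0.
have [rk Nk] := W12V_norm_rigidZ k rr.
have E0 (f : T -> T) : (fun x => k *: f x + 0 *: f x) = (fun x => k *: f x).
  by apply/funext => x; rewrite scale0r addr0.
have Lkh : L2M sigma Gamma (fun x => k *: h x).
  by have := L2M_lin mGamma k 0 Lh Lh; rewrite E0.
have kh : (fun x => k *: h x) = tr (fun x => k *: r x) %[ae sigma in Gamma].
  have hW := W12V_rigid oOmega bOmega rr.
  have := traceV_lin k 0 hW hW; rewrite !E0 => htr.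
  by apply: filterS2 hr htr => x /= hx ht Gx; rewrite ht// hx// scale0r addr0.
have EE : E (fun x => k *: h x) = (fun x => k *: r x).
  by apply: invE => //; exact/L2V_L2M.
rewrite -[X in X * _ <= _]gtr0_norm// -Nk -EE.
apply: ub_le_sup; first exact: op_norm_has_ubound.
exists (fun x => k *: h x) => //; split.
  by split; [exact/L2V_L2M|exists (fun x => k *: r x)].
by rewrite L2M_normZ// gtr0_norm// mulVf.
Qed.

Lemma op_norm_ge0 : 0 <= op_norm Omega Gamma gamma E.
Proof.
rewrite /op_norm; set S := [set _ | _ in _].
(* The supremum of the empty set is 0 by convention. *)
have [S0|/set0P[x Sx]] := eqVneq S set0; first by rewrite S0 sup0.
apply: le_trans (ub_le_sup op_norm_has_ubound Sx).
by case: Sx => g _ <-; exact: sqrtr_ge0.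
Qed.

End trace_theory.

(** * Measurability of [Gamma] and the final estimate *)

Lemma measurable_open_portion (R : realType) n (Omega Gamma : set 'rV[R]_n) :
  open_portion (boundary Omega) Gamma -> measurable Gamma.
Proof.
move=> [_ [U oU ->]]; apply: measurableI; first exact: measurable_open_rV.
apply: measurableD; first by apply: measurable_closed_rV; exact: closed_closure.
by apply: measurable_open_rV; exact: open_interior.
Qed.

(** Holds pointwise by [frob_dot_symM]; it makes the right-hand side of the final estimate vanish
    whenever the gradient does. *)
Lemma L2M_norm_symM (R : realType) n (Omega : set 'rV[R]_n) (G : 'rV[R]_n -> 'M[R]_n) :
  measurable Omega -> L2M (lebesgue_rV n) Omega G ->
  L2M_norm (lebesgue_rV n) Omega (fun x => symM (G x)) <=
  L2M_norm (lebesgue_rV n) Omega G.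
Proof.
move=> mO LG; rewrite !L2M_normE ler_wsqrtr//.
have LS : L2M (lebesgue_rV n) Omega (fun x => symM (G x)).
  have LT : L2M (lebesgue_rV n) Omega (fun x => (G x)^T).
    by move=> i j; have := LG j i; under [X in _ -> L2 _ _ X]eq_fun do rewrite mxE.
  have := L2M_lin mO 2^-1 2^-1 LG LT; congr L2M; apply/funext => x.
  by rewrite /symM scalerDr.
by apply: le_Rintegral => //; [exact: L2M_dot_integrable..|move=> x _; exact: frob_dot_symM].
Qed.

Theorem theorem5p7 (R : realType) (n : nat) (Omega Gamma : set 'rV[R]_n.+1)
    (Q K C : R)
    (gamma : ('rV[R]_n.+1 -> R) -> 'rV[R]_n.+1 -> R)
    (E P : ('rV[R]_n.+1 -> 'rV[R]_n.+1) -> 'rV[R]_n.+1 -> 'rV[R]_n.+1) :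
  open Omega -> connected Omega -> bounded_set Omega ->
  lipschitz_boundary Omega ->
  open_portion (boundary Omega) Gamma ->
  0 < Q ->
  (forall u G, W12 Omega u G ->
    L2_norm (lebesgue_rV n.+1) Omega
      (fun x => u x - mean (lebesgue_rV n.+1) Omega u) <=
    Q * L2M_norm (lebesgue_rV n.+1) Omega G) ->
  0 < K ->
  (forall (u : 'rV[R]_n.+1 -> 'rV[R]_n.+1) G, W12V Omega u G ->
    L2M_norm (lebesgue_rV n.+1) Omega
      (fun x => G x - skewM (meanM (lebesgue_rV n.+1) Omega G)) <=
    K * L2M_norm (lebesgue_rV n.+1) Omega (fun x => symM (G x))) ->
  is_trace Omega Gamma gamma ->
  (forall u G, W12 Omega u G ->
    L2_norm (hausdorff n) Gamma (gamma u) <= C * W12_norm Omega u G) ->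
  trace_rigid_inverse Gamma gamma E ->
  trace_rigid_projection Gamma gamma P ->
  forall (u : 'rV[R]_n.+1 -> 'rV[R]_n.+1) G, W12V Omega u G ->
    let rho := E \o P in
    let r := rho (traceV gamma u) in
    W12V_norm Omega (fun x => u x - r x) (fun x => G x - gradient r x) <=
    (1 + C * op_norm Omega Gamma gamma E) * K * Num.sqrt (1 + Q ^+ 2) *
      L2M_norm (lebesgue_rV n.+1) Omega (fun x => symM (G x)).
Proof.
move=> oO _ bO _ pG Q0 poincare K0 korn trg tC invE projP u G hu; cbv zeta.
rewrite [(E \o P) _]/=; set r := E _.
have mG := measurable_open_portion pG; have mO := measurable_open_rV oO.
have Lg : L2M (hausdorff n) Gamma (traceV gamma u) := traceV_L2M trg hu.
have [tP orth] := projP _ (proj2 (L2V_L2M Gamma _) Lg).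
have [rr LP Pr] := trace_rigid_inverseE invE tP.
rewrite -/r in rr Pr.
have hr := W12V_rigid oO bO rr.
have hur := W12VB oO bO hu hr.
set S := L2M_norm _ _ _.
(* The sign of [C] is not prescribed. If [C < 0], the trace bound forces every [W^{1,2}] norm to be
   0, so both sides of the estimate vanish. *)
have [C0|C0] := leP 0 C; last first.
  have W0 v H : W12 Omega v H -> W12_norm Omega v H = 0.
    move=> hv; apply/eqP; rewrite eq_le sqrtr_ge0 andbT.
    by rewrite -(nmulr_rge0 _ C0); apply: le_trans (tC _ _ hv); exact: sqrtr_ge0.
  have WV0 (v : 'rV[R]_n.+1 -> 'rV[R]_n.+1) H : W12V Omega v H -> W12V_norm Omega v H = 0.
    move=> hv; apply/eqP; rewrite -sqrf_eq0 W12V_norm_sum//.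
    by apply/eqP; apply: big1 => i _; rewrite W0// expr0n.
  have -> : S = 0.
    apply/eqP; rewrite eq_le L2M_norm_ge0 andbT.
    have LG := W12V_L2M_gradient hu.
    apply: le_trans (L2M_norm_symM mO LG) _.
    rewrite -(@ler_pXn2r _ 2)// ?nnegrE ?L2M_norm_ge0//.
    have := W12V_norm_sum_parts oO hu; rewrite WV0// expr0n/= => ->.
    by rewrite lerDr sumr_ge0// => i _; exact: sqr_ge0.
  by rewrite mulr0 WV0.
have [w rw hw] := rigid_approximation oO bO Q0 K0 poincare (korn _ _ hu) hu.
have hW := W12V_rigid oO bO rw.
have huw := W12VB oO bO hu hW.
have [rs gs] := rigid_lin 1 (-1) rw rr.
(* [s] is the rigid displacement [w - r], and [h] represents its trace because [P (traceV gamma u)]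
   represents that of [r]. *)
pose s x := 1 *: w x + (-1) *: r x.
pose h x := 1 *: traceV gamma w x + (-1) *: P (traceV gamma u) x.
have Lw := traceV_L2M trg hW.
have Lh : L2M (hausdorff n) Gamma h by exact: L2M_lin.
have hs : h = traceV gamma s %[ae (hausdorff n) in Gamma].
  have := traceV_lin trg 1 (-1) hW hr => ht.
  by apply: filterS2 Pr ht => x /= Px tx Gx; rewrite tx// /h Px.
have norm_s := ler_op_norm oO bO mG trg invE rs Lh hs.
(* The contraction property of the projection: the trace of [u - w] is [e - h], where [e], the
   residual of the projection, is orthogonal to [h]; by Pythagoras the norm of [h] is at most that
   of this trace. *)
have norm_h : L2M_norm (hausdorff n) Gamma h <=
    C * W12V_norm Omega (fun x => u x - w x) (fun x => G x - gradient w x).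
  apply: le_trans (traceV_bound oO mG trg C0 tC huw).
  pose e x := traceV gamma u x - P (traceV gamma u) x.
  have Le : L2M (hausdorff n) Gamma e by exact: L2MB.
  have eh : L2M_inner (hausdorff n) Gamma e h = 0.
    rewrite -L2V_innerE; apply: orth; split; first exact/L2V_L2M.
    by exists s.
  have Lt := traceV_L2M trg huw.
  have ae_t : traceV gamma (fun x => u x - w x) = (fun x => 1 *: e x + (-1) *: h x)
      %[ae (hausdorff n) in Gamma].
    have := traceV_lin trg 1 (-1) hu hW.
    rewrite (_ : (fun x => 1 *: u x + (-1) *: w x) = (fun x => u x - w x)); last first.
      by apply/funext => x; rewrite scale1r scaleN1r.
    apply: filterS => x /= + Gx => /(_ Gx) ->.
    by rewrite /e /h !scale1r !scaleN1r opprB addrA subrK.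
  rewrite (L2M_norm_ae mG Lt (L2M_lin mG 1 (-1) Le Lh) ae_t) !L2M_normE.
  rewrite L2M_inner_lin// eh mulr0 addr0 sqrrN expr1n !mul1r ler_wsqrtr// lerDr.
  exact: L2M_inner_ge0.
set X := W12V_norm Omega (fun x => u x - w x) _ in hw norm_h.
have X0 : 0 <= X by exact: sqrtr_ge0.
have E0 := op_norm_ge0 oO bO mG trg invE.
(* Since [hw] bounds [X], the norm of [u - r] only has to be compared with [X], by splitting it as
   [(u - w) + s]. *)
apply: (@le_trans _ _ ((1 + C * op_norm Omega Gamma gamma E) * X)); last first.
  rewrite -2!mulrA ler_wpM2l ?addr_ge0 ?mulr_ge0//.
  by rewrite mulrA.
have := ler_W12V_normD oO huw (W12V_rigid oO bO rs).
have E1 p q (f g k : 'rV[R]_n.+1 -> 'M[R]_(p, q)) :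
    (fun x => f x - g x + (1 *: g x + (-1) *: k x)) = (fun x => f x - k x).
  by apply/funext => x; rewrite scale1r scaleN1r addrA subrK.
rewrite gs !E1 => /le_trans; apply; rewrite -gs mulrDl mul1r lerD2l.
apply: le_trans norm_s _; rewrite mulrAC [leRHS]mulrC.
by rewrite ler_wpM2l.
Qed.
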